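(* Let $1\le p<\infty$ and $g\in H(\mathbb{D})$. Then the Volterra type operator $T_g: S_2^p\to S_2^p$, $T_gf(z)=\int_0^z f(w)g'(w)\,dw$, is bounded if and only if $g\in S_2^p$.
   Context: $\mathbb{D}$ is the open unit disc, $H(\mathbb{D})$ the space of analytic functions on $\mathbb{D}$. For $1\le p<\infty$, $H^p$ is the Hardy space of $f\in H(\mathbb{D})$ with $\|f\|_{H^p}^p=\sup_{0<r<1}\frac{1}{2\pi}\int_0^{2\pi}|f(re^{i\theta})|^p\,d\theta<\infty$. $S_2^p=\{f\in H(\mathbb{D}): f''\in H^p\}$ with norm $\|f\|_{S_2^p}=|f(0)|+|f'(0)|+\|f''\|_{H^p}$. *)

(* Defs.v *)
From HB Require Import structures.
From mathcomp Require Import all_boot all_order all_algebra.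
From mathcomp Require Import complex.
From mathcomp Require Import all_classical all_reals all_analysis.
Set Implicit Arguments. Unset Strict Implicit. Unset Printing Implicit Defensive.
Import Order.TTheory GRing.Theory Num.Theory.
Import numFieldNormedType.Exports.
Local Open Scope classical_set_scope.
Local Open Scope ring_scope.
Local Open Scope complex_scope.

Section Defs.
Variable R : realType.
Local Notation C := (R[i])^o.

Definition cmod (z : C) : R := Normc.normc z.

Definition analytic_disc (f : C -> C) : Prop :=
  forall z : C, cmod z < 1 -> derivable f z 1.

Definition cderiv (f : C -> C) : C -> C := derive1 f.

Definition expi (t : R) : C := (cos t) +i* (sin t).

Definition Mp_pow (p : R) (f : C -> C) (r : R) : \bar R :=
  ((2 * pi)^-1)%:E *
  (\int[lebesgue_measure]_(t in `[0%R, (2 * pi)%R]) ((cmod (f (r%:C * expi t))) `^ p)%:E)%E.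

Definition Hp_pow (p : R) (f : C -> C) : \bar R :=
  ereal_sup [set Mp_pow p f r | r in `]0%R, 1%R[].

Definition in_Hp (p : R) (f : C -> C) : Prop :=
  analytic_disc f /\ (Hp_pow p f < +oo)%E.

Definition Hp_norm (p : R) (f : C -> C) : R := (fine (Hp_pow p f)) `^ p^-1.

Definition in_S2p (p : R) (f : C -> C) : Prop :=
  analytic_disc f /\ in_Hp p (cderiv (cderiv f)).

Definition S2p_norm (p : R) (f : C -> C) : R :=
  cmod (f 0) + cmod (cderiv f 0) + Hp_norm p (cderiv (cderiv f)).

Definition cint01 (h : R -> C) : C :=
  (Rintegral lebesgue_measure `[0%R, 1%R] (fun t => complex.Re (h t)))
  +i* (Rintegral lebesgue_measure `[0%R, 1%R] (fun t => complex.Im (h t))).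

(* Volterra operator T_g f (z) = int_0^z f(w) g'(w) dw, along the segment [0,z]:
   = int_0^1 f(tz) g'(tz) z dt *)
Definition Tg (g f : C -> C) : C -> C :=
  fun z => cint01 (fun t => f (t%:C * z) * cderiv g (t%:C * z) * z).

Definition Tg_bounded_S2p (p : R) (g : C -> C) : Prop :=
  (forall f, in_S2p p f -> in_S2p p (Tg g f)) /\
  exists K : R, forall f, in_S2p p f -> S2p_norm p (Tg g f) <= K * S2p_norm p f.

End Defs.

(* Main.v *)
Require Import Defs.
From HB Require Import structures.
From mathcomp Require Import all_boot all_order all_algebra.
From mathcomp Require Import complex ring lra.
From mathcomp Require Import all_classical all_reals all_analysis.
From mathcomp Require Import measurable_realfun.
Set Implicit Arguments. Unset Strict Implicit. Unset Printing Implicit Defensive.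
Import Order.TTheory GRing.Theory Num.Theory.
Import numFieldNormedType.Exports.
Local Open Scope ring_scope.
Local Open Scope classical_set_scope.
Local Open Scope complex_scope.

(** Testing the operator on the constant function 1 gives g - g(0), hence g is
    in S_2^p when T_g is bounded.  Conversely (T_g f)'' = f' g' + f g'', so it is
    enough that f and f' are bounded on the disc by a multiple of the norm of f:
    on a circle of radius r the oscillation of f' is at most the L^1 mean of f'',
    which is at most twice its H^p norm, and the mean of f' over the circle is
    f'(0).

    All the complex analysis rests on Goursat's bisection argument, carried out on
    a rectangle [a, b] x [c, d] of parameters and pulled back by a homotopy Phi:
    the homotopy from the circle |w| = r to a small circle around z gives Cauchy's
    formula (hence the analyticity of f'), and Phi(s, t) = t (z + s (w - z)) gives
    the primitive of f obtained by integrating along rays. *)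

(** Analyticity is given as mere differentiability at each point, with no continuity of the
    derivative, so Green's formula is out of reach. Even the second derivative of f has no meaning
    until Cauchy's formula is available. Goursat's argument therefore has to carry everything.
    Working over a rectangle of parameters, rather than with triangles in the plane, lets a side
    collapse to a point or two sides coincide. One statement then serves both the circles and the
    rays. Integrals of complex paths are taken on real and imaginary parts, and bounding the two
    separately costs a factor 2 in each estimate. This is the origin of many of the twos in the
    constants; only the existence of some constant matters in the end. In the converse direction the
    sup bound is used twice: for f, where it controls f and f', and for g, where it controls g'. The
    only factor left unbounded is g'', and it enters linearly. *)

(** Multiplying the difference quotient by the increment clears the denominator, and at [y = x] both
    sides vanish, so the punctured neighbourhood becomes a full one. The general field covers real
    and complex derivatives at once. *)
Lemma is_derive_littleoP (K : numFieldType) (f : K -> K) (x d : K) :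
  is_derive x 1 f d <->
  forall e : K, 0 < e ->
    \forall y \near x, `|f y - f x - d * (y - x)| <= e * `|y - x|.
Proof.
have key (e h : K) : h != 0 ->
    (`|d - h^-1 *: (f (h *: 1 + x) - f x)| <= e) =
    (`|f (h + x) - f x - d * h| <= e * `|h|).
  move=> h0; rewrite /GRing.scale /= mulr1 -(ler_pM2r (_ : 0 < `|h|)) ?normr_gt0//.
  by rewrite -normrM distrC mulrBl mulrAC mulVf// mul1r.
split=> [[df Df] e e0|H].
  have := df; rewrite /derivable => /cvg_ex[l Hl].
  have ld : l = d by rewrite -Df; apply/esym/cvg_lim.
  move: Hl; rewrite ld => /cvgrPdist_le/(_ e e0); rewrite near_withinE.
  move=> /nbhs_ballP[r r0 rP]; apply/nbhs_ballP; exists r => // y /= xy.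
  have [->|yx] := eqVneq y x; first by rewrite !subrr mulr0 subr0 normr0 mulr0.
  have := rP (y - x); rewrite /= /ball /= sub0r normrN.
  move: xy; rewrite /ball /= distrC => xy /(_ xy).
  by rewrite subr_eq0 yx => /(_ isT); rewrite key ?subr_eq0// subrK.
have cv : h^-1 *: ((f \o shift x) (h *: 1) - f x) @[h --> 0^'] --> d.
  apply/cvgrPdist_le => e e0; rewrite near_withinE.
  have /nbhs_ballP[r r0 rP] := H e e0.
  apply/nbhs_ballP; exists r => // h /= xh h0.
  rewrite key//; have := rP (h + x); rewrite addrK; apply.
  by move: xh; rewrite /ball /= sub0r normrN opprD addrCA subrr addr0 normrN.
by apply: DeriveDef; [apply/cvg_ex; exists d|exact: cvg_lim].
Qed.

(** * The real-valued modulus and neighbourhoods in the complex plane *)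

Section Modulus.
Variable R : realType.
Local Notation C := (R[i])^o.
Implicit Types z w : C.

Lemma norm_cmod z : `|z| = (cmod z)%:C.
Proof. by case: z. Qed.

Lemma cmod0 : cmod (0 : C) = 0. Proof. exact: Normc.normc0. Qed.
Lemma cmodM z w : cmod (z * w) = cmod z * cmod w. Proof. exact: Normc.normcM. Qed.
Lemma cmodV z : cmod z^-1 = (cmod z)^-1. Proof. exact: Normc.normcV. Qed.
Lemma cmodN z : cmod (- z) = cmod z. Proof. exact: normcN. Qed.
Lemma cmodD z w : cmod (z + w) <= cmod z + cmod w. Proof. exact: le_normcD. Qed.
Lemma cmodB z w : cmod (z - w) = cmod (w - z). Proof. by rewrite -cmodN opprB. Qed.
Lemma cmod_ge0 z : 0 <= cmod z.
Proof. by case: z => a b; rewrite /cmod /= sqrtr_ge0. Qed.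
Lemma cmod_i : cmod ('i : C) = 1.
Proof. by rewrite /cmod /= expr0n expr1n add0r sqrtr1. Qed.
Lemma cmod_real (a : R) : cmod (a%:C : C) = `|a|.
Proof. by rewrite /cmod /= expr0n addr0 sqrtr_sqr. Qed.
Lemma cmod_eq0 z : (cmod z == 0) = (z == 0).
Proof.
by apply/eqP/eqP => [|->]; [exact: Normc.eq0_normc|rewrite cmod0].
Qed.
Lemma cmod_gt0 z : (0 < cmod z) = (z != 0).
Proof. by rewrite lt_def cmod_ge0 andbT cmod_eq0. Qed.
Lemma Re_le_cmod z : `|complex.Re z| <= cmod z.
Proof. by have := normc_ge_Re z; rewrite norm_cmod lecR. Qed.
Lemma Im_le_cmod z : `|complex.Im z| <= cmod z.
Proof.
case: z => a b; rewrite /cmod /= -sqrtr_sqr ler_wsqrtr//.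
by rewrite lerDr sqr_ge0.
Qed.
Lemma cmod_le_ReIm z : cmod z <= `|complex.Re z| + `|complex.Im z|.
Proof.
case: z => a b; have -> : a +i* b = (a%:C : C) + (b%:C * 'i) :> C.
  by apply/eqP; rewrite eq_complex /=; apply/andP; split; apply/eqP; ring.
rewrite (le_trans (cmodD _ _))// cmodM !cmod_real.
rewrite cmod_i mulr1 lerD//=; rewrite ?mul0r ?mulr0 ?mulr1 ?subr0 ?addr0 ?add0r //.
Qed.

(** Balls of [C] have their radius in [R[i]], where positivity forces the imaginary part to be 0;
    what remains is a real radius. *)
Lemma near_cmodP (z : C) (P : C -> Prop) :
  (\forall w \near z, P w) <->
  exists2 e : R, 0 < e & forall w, cmod (w - z) < e -> P w.
Proof.
split.
  move=> /nbhs_ballP[[e1 e2] /= e0 eP].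
  have e10 : 0 < e1 by move: e0; rewrite ltcE /= => /andP[_].
  have e20 : e2 = 0 by move: e0; rewrite ltcE /= => /andP[/eqP].
  exists e1 => // w wz; apply: eP; rewrite /ball /= norm_cmod e20 -/(e1%:C) ltcR.
  by rewrite cmodB.
move=> [e e0 eP]; apply/nbhs_ballP; exists e%:C; first by rewrite /= ltcR.
by move=> w; rewrite /ball /= norm_cmod ltcR cmodB => /eP.
Qed.

End Modulus.

(** * Complex-valued paths and their integrals *)

Section Paths.
Variable R : realType.
Local Notation C := (R[i])^o.
Implicit Types (h k : R -> C) (a b t : R) (z w d : C).

Lemma cReD z w : complex.Re (z + w) = complex.Re z + complex.Re w.
Proof. by case: z; case: w. Qed.
Lemma cImD z w : complex.Im (z + w) = complex.Im z + complex.Im w.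
Proof. by case: z; case: w. Qed.
Lemma cReN z : complex.Re (- z) = - complex.Re z. Proof. by case: z. Qed.
Lemma cImN z : complex.Im (- z) = - complex.Im z. Proof. by case: z. Qed.
Lemma cReM z w :
  complex.Re (z * w) = complex.Re z * complex.Re w - complex.Im z * complex.Im w.
Proof. by case: z; case: w. Qed.
Lemma cImM z w :
  complex.Im (z * w) = complex.Re z * complex.Im w + complex.Im z * complex.Re w.
Proof. by case: z; case: w. Qed.
Definition ReImE := (cReD, cImD, cReN, cImN, cReM, cImM).

Lemma complex_ext z w :
  complex.Re z = complex.Re w -> complex.Im z = complex.Im w -> z = w.
Proof. by case: z; case: w => a b c d /= -> ->. Qed.

Lemma Re_continuous : forall z, (fun w : C => complex.Re w : R) @ z --> complex.Re z.
Proof.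
move=> z; have FF : Filter (nbhs (z : C)) by exact: nbhs_filter.
apply/cvgrPdist_lt => e e0; apply/near_cmodP; exists e => // w wz.
by rewrite -cReN -cReD (le_lt_trans (Re_le_cmod _))// cmodB.
Qed.

Lemma Im_continuous : forall z, (fun w : C => complex.Im w : R) @ z --> complex.Im z.
Proof.
move=> z; have FF : Filter (nbhs (z : C)) by exact: nbhs_filter.
apply/cvgrPdist_lt => e e0; apply/near_cmodP; exists e => // w wz.
by rewrite -cImN -cImD (le_lt_trans (Im_le_cmod _))// cmodB.
Qed.

Lemma cmod_continuous : forall z, (fun w : C => cmod w : R) @ z --> cmod z.
Proof.
move=> z; have FF : Filter (nbhs (z : C)) by exact: nbhs_filter.
apply/cvgrPdist_lt => e e0; apply/near_cmodP; exists e => // w wz.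
apply: le_lt_trans wz; rewrite ler_norml; apply/andP; split.
  have := cmodD (w - z) z; rewrite subrK; lra.
have := cmodD (z - w) w; rewrite subrK cmodB; lra.
Qed.

(** The parameter is real and the values are complex. Splitting into components matches the
    componentwise integral, and [path_derivP] recovers the estimate in modulus. *)
Definition path_deriv h t d :=
  is_derive t 1 (fun u => complex.Re (h u)) (complex.Re d) /\
  is_derive t 1 (fun u => complex.Im (h u)) (complex.Im d).

Lemma path_derivP h t d : path_deriv h t d <->
  forall e : R, 0 < e -> \forall u \near t,
    cmod (h u - h t - d * (u - t)%:C) <= e * `|u - t|.
Proof.
split.
  move=> [/is_derive_littleoP hR /is_derive_littleoP hI] e e0.
  have e20 : 0 < e / 2 by rewrite divr_gt0.
  move: (hR _ e20) (hI _ e20); apply: filterS2 => u uR uI.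
  apply: le_trans (cmod_le_ReIm _) _; rewrite !ReImE /= !mulr0 subr0 add0r.
  by move: uR uI; lra.
move=> H; split; apply/is_derive_littleoP => e e0; move: (H e e0);
  apply: filterS => u; apply: le_trans.
- by apply: le_trans (Re_le_cmod _); rewrite !ReImE /= mulr0 subr0.
- by apply: le_trans (Im_le_cmod _); rewrite !ReImE /= mulr0 add0r.
Qed.

Lemma path_deriv_cvg h t d : path_deriv h t d -> h u @[u --> t] --> h t.
Proof.
move=> /path_derivP/(_ 1 ltr01) H; apply/cvgrPdist_lt => -[e1 e2] e0.
have e10 : 0 < e1 by move: e0; rewrite ltcE /= => /andP[_].
have e20 : e2 = 0 by move: e0; rewrite ltcE /= => /andP[/eqP].
have K0 : 0 < 1 + cmod d by rewrite ltr_pwDl// cmod_ge0.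
near=> u; rewrite e20 norm_cmod ltcR cmodB.
have -> : h u - h t = (h u - h t - d * (u - t)%:C) + d * (u - t)%:C.
  by rewrite subrK.
apply: le_lt_trans (cmodD _ _) _.
rewrite cmodM cmod_real.
have : `|u - t| < e1 / (1 + cmod d).
  by rewrite distrC; near: u; apply/nbhs_ballP; exists (e1 / (1 + cmod d)) => //=; exact: divr_gt0.
rewrite ltr_pdivlMr// mulrDr mulr1 [_ * cmod d]mulrC; apply: le_lt_trans.
rewrite lerD2r -[leRHS]mul1r; near: u; exact: H.
Unshelve. all: end_near. Qed.

Lemma path_deriv_cst z t : path_deriv (fun=> z) t 0.
Proof. by split; exact: is_derive_cst. Qed.

Lemma path_deriv_real t : path_deriv (fun u => u%:C) t 1.
Proof. by split => /=; [exact: is_derive_id|exact: is_derive_cst]. Qed.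

Lemma path_derivD h k t d d' : path_deriv h t d -> path_deriv k t d' ->
  path_deriv (fun u => h u + k u) t (d + d').
Proof.
move=> [hR hI] [kR kI]; split.
  rewrite cReD; under eq_fun do rewrite cReD; exact: is_deriveD.
rewrite cImD; under eq_fun do rewrite cImD; exact: is_deriveD.
Qed.

Lemma path_derivM h k t d d' : path_deriv h t d -> path_deriv k t d' ->
  path_deriv (fun u => h u * k u) t (h t * d' + d * k t).
Proof.
move=> [hR hI] [kR kI]; split.
  rewrite !ReImE; under eq_fun do rewrite cReM.
  apply: is_derive_eq; rewrite /GRing.scale /=; ring.
rewrite !ReImE; under eq_fun do rewrite cImM.
apply: is_derive_eq; rewrite /GRing.scale /=; ring.
Qed.

Lemma path_deriv_comp (f : C -> C) h t d d' :
  is_derive (h t) 1 f d -> path_deriv h t d' ->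
  path_deriv (fun u => f (h u)) t (d * d').
Proof.
move=> /is_derive_littleoP ff hd; apply/path_derivP => e e0.
have hc := path_deriv_cvg hd; move/path_derivP in hd.
pose M := cmod d + cmod d' + 1.
have M0 : 0 < M by rewrite /M ltr_wpDl// addr_ge0// cmod_ge0.
have M1 : 1 <= M by rewrite /M lerDr addr_ge0// cmod_ge0.
(* The total error is [e1 (e1 + |d'| + |d|) |u - t|]; with [e1 <= 1] the bracket is at most [M]. *)
pose e1 := Num.min 1 (e / (2 * M)).
have e10 : 0 < e1 by rewrite lt_min ltr01 /= divr_gt0// mulr_gt0.
have e1M : 2 * M * e1 <= e.
  by rewrite mulrC -ler_pdivlMr ?mulr_gt0// ge_min lexx orbT.
have e11 : e1 <= 1 by rewrite ge_min lexx.
near=> u.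
have h1 : cmod (h u - h t - d' * (u - t)%:C) <= e1 * `|u - t|.
  by near: u; exact: hd.
have f1 : cmod (f (h u) - f (h t) - d * (h u - h t)) <= e1 * cmod (h u - h t).
  have : `|f (h u) - f (h t) - d * (h u - h t)| <= e1%:C * `|h u - h t|.
    near: u; have e1C : 0 < e1%:C :> R[i] by rewrite ltcR.
    exact: (hc _ (ff _ e1C)).
  by rewrite !norm_cmod -rmorphM lecR.
have -> : f (h u) - f (h t) - d * d' * (u - t)%:C =
  (f (h u) - f (h t) - d * (h u - h t)) + d * (h u - h t - d' * (u - t)%:C).
  by ring.
apply: le_trans (cmodD _ _) _; rewrite cmodM.
have h2 : cmod (h u - h t) <= (e1 + cmod d') * `|u - t|.
  rewrite -[h u - h t](subrK (d' * (u - t)%:C)).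
  by apply: le_trans (cmodD _ _) _; rewrite cmodM cmod_real mulrDl lerD2r.
have d0 := cmod_ge0 d; have d'0 := cmod_ge0 d'; have u0 := normr_ge0 (u - t).
apply: (@le_trans _ _ (e1 * ((e1 + cmod d') * `|u - t|) + cmod d * (e1 * `|u - t|))).
  by rewrite lerD// ?(le_trans f1)// ler_wpM2l// ltW.
have -> : e1 * ((e1 + cmod d') * `|u - t|) + cmod d * (e1 * `|u - t|) =
  (e1 * (e1 + cmod d' + cmod d)) * `|u - t| by ring.
rewrite ler_wpM2r//; apply: le_trans e1M; rewrite mulrC ler_wpM2r ?(ltW e10)//.
by rewrite /M; lra.
Unshelve. all: end_near. Qed.

Lemma path_deriv_expi t : path_deriv (@expi R) t ('i * expi t).
Proof.
split; rewrite /expi /= !mul0r !mul1r ?sub0r ?add0r; exact: is_derive_eq.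
Qed.

Lemma cmod_expi t : cmod (expi t) = 1.
Proof. by rewrite /cmod /= cos2Dsin2 sqrtr1. Qed.

End Paths.

(** * Integrals of complex paths over a segment *)

Section PathIntegral.
Variable R : realType.
Local Notation C := (R[i])^o.
Local Notation mu := (@lebesgue_measure R).
Implicit Types (h k : R -> C) (a b t : R) (z w d : C).

Lemma integrable_segment a b (f : R -> R) :
  (forall t, a <= t <= b -> f u @[u --> t] --> f t) ->
  mu.-integrable `[a, b] (EFin \o f).
Proof.
move=> fc; apply: continuous_compact_integrable; first exact: segment_compact.
by apply: continuous_in_subspaceT => t; rewrite inE /= in_itv /= => /fc.
Qed.

Lemma Rintegral_FTC a b (f F : R -> R) : a <= b ->
  (forall t, a <= t <= b -> f u @[u --> t] --> f t) ->
  (forall t, a <= t <= b -> is_derive t 1 F (f t)) ->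
  \int[mu]_(t in `[a, b]) f t = F b - F a.
Proof.
rewrite le_eqVlt => /predU1P[-> _ _|ab fc fF].
  by rewrite set_itv1 Rintegral_set1 subrr.
have Fc t : a <= t <= b -> F u @[u --> t] --> F t.
  move=> tab; apply: differentiable_continuous; apply/derivable1_diffP.
  by have [] := fF t tab.
rewrite /Rintegral (@continuous_FTC2 R f F)//.
- by apply: continuous_in_subspaceT => t; rewrite inE /= in_itv /= => /fc.
- split.
  + move=> t; rewrite in_itv /= => /andP[/ltW at' /ltW tb].
    by have [] := fF t; rewrite ?at' ?tb.
  + by apply/cvg_at_right_filter/Fc; rewrite lexx ltW.
  + by apply/cvg_at_left_filter/Fc; rewrite lexx ltW.
- move=> t; rewrite in_itv /= => /andP[/ltW at' /ltW tb].
  by rewrite derive1E; have [] := fF t; rewrite ?at' ?tb.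
Qed.

Definition cint a b h : C :=
  (Rintegral mu `[a, b] (fun t => complex.Re (h t)))
  +i* (Rintegral mu `[a, b] (fun t => complex.Im (h t))).

(** The limits are two-sided even at the end points: every path in use is defined on the whole
    line. *)
Record ccont a b h : Prop :=
  Ccont { ccont_cvg : forall t, a <= t <= b -> h u @[u --> t] --> h t }.

Lemma ccont_Re a b h : ccont a b h ->
  forall t, a <= t <= b -> complex.Re (h u) @[u --> t] --> complex.Re (h t).
Proof.
by move=> [hc] t /hc ht; apply: (cvg_comp h (fun w => complex.Re w) ht);
  exact: Re_continuous.
Qed.

Lemma ccont_Im a b h : ccont a b h ->
  forall t, a <= t <= b -> complex.Im (h u) @[u --> t] --> complex.Im (h t).
Proof.
by move=> [hc] t /hc ht; apply: (cvg_comp h (fun w => complex.Im w) ht);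
  exact: Im_continuous.
Qed.

Lemma ccont_cmod a b h : ccont a b h ->
  forall t, a <= t <= b -> cmod (h u) @[u --> t] --> cmod (h t).
Proof.
by move=> [hc] t /hc ht; apply: (cvg_comp h (fun w => cmod w) ht);
  exact: cmod_continuous.
Qed.

Lemma ccont_sub a b a' b' h : ccont a b h -> a <= a' -> b' <= b -> ccont a' b' h.
Proof.
move=> [hc] aa bb; split=> t /andP[ta tb]; apply: hc.
by rewrite (le_trans aa ta) (le_trans tb bb).
Qed.

Lemma ccont_cst a b z : ccont a b (fun=> z).
Proof. by split=> t _; exact: cvg_cst. Qed.

Lemma ccontD a b h k : ccont a b h -> ccont a b k ->
  ccont a b (fun t => h t + k t).
Proof. by move=> [hc] [kc]; split=> t tab; apply: cvgD; [exact: hc|exact: kc]. Qed.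

Lemma ccontM a b h k : ccont a b h -> ccont a b k ->
  ccont a b (fun t => h t * k t).
Proof. by move=> [hc] [kc]; split=> t tab; apply: cvgM; [exact: hc|exact: kc]. Qed.

Lemma ccontN a b h : ccont a b h -> ccont a b (fun t => - h t).
Proof. by move=> [hc]; split=> t tab; apply: cvgN; exact: hc. Qed.

Lemma ccontV a b h : (forall t, a <= t <= b -> h t != 0) ->
  ccont a b h -> ccont a b (fun t => (h t)^-1).
Proof. by move=> h0 [hc]; split=> t tab; apply: cvgV; [exact: h0|exact: hc]. Qed.

Lemma ccont_comp a b (f : C -> C) h : ccont a b h ->
  (forall t, a <= t <= b -> derivable f (h t) 1) -> ccont a b (fun t => f (h t)).
Proof.
move=> [hc] hf; split=> t tab; apply: (cvg_comp h f (hc t tab)).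
by have /derivable1_diffP/differentiable_continuous := hf t tab.
Qed.

Lemma ccont_deriv a b h k : (forall t, a <= t <= b -> path_deriv h t (k t)) ->
  ccont a b h.
Proof. by move=> hk; split=> t tab; apply: path_deriv_cvg; exact: hk. Qed.

Lemma integrable_Re a b h : ccont a b h ->
  mu.-integrable `[a, b] (EFin \o (fun t => complex.Re (h t))).
Proof. by move=> hc; apply: integrable_segment; exact: ccont_Re. Qed.

Lemma integrable_Im a b h : ccont a b h ->
  mu.-integrable `[a, b] (EFin \o (fun t => complex.Im (h t))).
Proof. by move=> hc; apply: integrable_segment; exact: ccont_Im. Qed.

Lemma integrable_cmod a b h : ccont a b h ->
  mu.-integrable `[a, b] (EFin \o (fun t => cmod (h t))).
Proof. by move=> hc; apply: integrable_segment; exact: ccont_cmod. Qed.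

Lemma eq_cint a b h k : (forall t, a <= t <= b -> h t = k t) ->
  cint a b h = cint a b k.
Proof.
move=> hk; congr (_ +i* _); apply: eq_Rintegral => t;
  by rewrite inE /= in_itv /= => /hk ->.
Qed.

Lemma cintD a b h k : ccont a b h -> ccont a b k ->
  cint a b (fun t => h t + k t) = cint a b h + cint a b k.
Proof.
move=> hc kc; apply: complex_ext; rewrite !ReImE /=.
  under eq_Rintegral do rewrite cReD.
  by rewrite RintegralD//; exact: integrable_Re.
under eq_Rintegral do rewrite cImD.
by rewrite RintegralD//; exact: integrable_Im.
Qed.

Lemma cintZ a b z h : ccont a b h ->
  cint a b (fun t => z * h t) = z * cint a b h.
Proof.
move=> hc.
have iR (x : R) : mu.-integrable `[a, b] (EFin \o (fun t => x * complex.Re (h t))).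
  apply: integrable_segment => t tab.
  by apply: cvgM; [exact: cvg_cst|exact: (ccont_Re hc)].
have iI (x : R) : mu.-integrable `[a, b] (EFin \o (fun t => x * complex.Im (h t))).
  apply: integrable_segment => t tab.
  by apply: cvgM; [exact: cvg_cst|exact: (ccont_Im hc)].
apply: complex_ext; rewrite !ReImE /=.
  under eq_Rintegral do rewrite cReM.
  by rewrite RintegralB// !RintegralZl//; [exact: integrable_Im|exact: integrable_Re].
under eq_Rintegral do rewrite cImM.
by rewrite RintegralD// !RintegralZl//; [exact: integrable_Re|exact: integrable_Im].
Qed.

Lemma cintB a b h k : ccont a b h -> ccont a b k ->
  cint a b (fun t => h t - k t) = cint a b h - cint a b k.
Proof.
move=> hc kc; have kc' : ccont a b (fun t => (- 1) * k t).
  exact: (ccontM (@ccont_cst a b (- 1)) kc).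
transitivity (cint a b (fun t => h t + (- 1) * k t)).
  by apply: eq_cint => t _; rewrite mulN1r.
by rewrite cintD// cintZ// mulN1r.
Qed.

Lemma cint_chasles a m b h : a <= m <= b -> ccont a b h ->
  cint a b h = cint a m h + cint m b h.
Proof.
move=> /andP[am mb] hc.
have cut (f : R -> R) : mu.-integrable `[a, b] (EFin \o f) ->
    Rintegral mu `[a, b] f = Rintegral mu `[a, m] f + Rintegral mu `[m, b] f.
  move=> fi; apply/eqP; rewrite addrC -subr_eq Rintegral_itvB ?bnd_simp//.
  apply/eqP; apply: Rintegral_itv_obnd_cbnd.
  apply: integrableS fi => //; apply: subset_itv; rewrite bnd_simp//.
by apply: complex_ext; rewrite !ReImE /=; apply: cut;
  [exact: integrable_Re|exact: integrable_Im].
Qed.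

Lemma cint_FTC a b h k : a <= b -> ccont a b k ->
  (forall t, a <= t <= b -> path_deriv h t (k t)) ->
  cint a b k = h b - h a.
Proof.
move=> ab kc hk; apply: complex_ext; rewrite !ReImE /=.
  apply: (@Rintegral_FTC _ _ _ (fun t => complex.Re (h t))) => //.
    exact: ccont_Re.
  by move=> t /hk[].
apply: (@Rintegral_FTC _ _ _ (fun t => complex.Im (h t))) => //.
  exact: ccont_Im.
by move=> t /hk[].
Qed.

(** The factor 2 comes from adding the bounds for the real and imaginary parts, each dominated by
    the modulus. *)
Lemma cmod_cint_le a b h : ccont a b h ->
  cmod (cint a b h) <= 2 * \int[mu]_(t in `[a, b]) cmod (h t).
Proof.
move=> hc; apply: le_trans (cmod_le_ReIm _) _; rewrite mulrDl !mul1r /=.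
have ic := integrable_cmod hc.
have iabs (f : R -> R) : (forall t, a <= t <= b -> f u @[u --> t] --> f t) ->
    mu.-integrable `[a, b] (EFin \o (fun t => `|f t|)).
  by move=> fc; apply: integrable_segment => t tab; apply: cvg_norm; exact: fc.
apply: lerD.
  apply: le_trans (le_normr_Rintegral _ (integrable_Re hc)) _ => //.
  apply: le_Rintegral => //; first exact/iabs/ccont_Re.
  by move=> t _; exact: Re_le_cmod.
apply: le_trans (le_normr_Rintegral _ (integrable_Im hc)) _ => //.
apply: le_Rintegral => //; first exact/iabs/ccont_Im.
by move=> t _; exact: Im_le_cmod.
Qed.

Lemma Rintegral_le_cst a b (f : R -> R) M : a <= b ->
  (forall t, a <= t <= b -> f u @[u --> t] --> f t) ->
  (forall t, a <= t <= b -> f t <= M) ->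
  \int[mu]_(t in `[a, b]) f t <= M * (b - a).
Proof.
move=> ab fc fM; have -> : M * (b - a) = \int[mu]_(_ in `[a, b]) M.
  rewrite Rintegral_cst//= lebesgue_measure_itv/= lte_fin.
  move: ab; rewrite le_eqVlt => /predU1P[->|->]; last by [].
  by rewrite ltxx subrr.
apply: le_Rintegral => //.
- exact: integrable_segment.
- by apply: integrable_segment => t _; exact: cvg_cst.
Qed.

Lemma cmod_cint_le_cst a b h M : a <= b -> ccont a b h ->
  (forall t, a <= t <= b -> cmod (h t) <= M) ->
  cmod (cint a b h) <= 2 * M * (b - a).
Proof.
move=> ab hc hM; apply: le_trans (cmod_cint_le hc) _.
by rewrite -mulrA ler_pM2l// Rintegral_le_cst//; exact: ccont_cmod.
Qed.

End PathIntegral.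

(** * Goursat's theorem *)

Section Bisection.
Variable R : realType.

(** The supremum of the left ends works: by monotonicity every left end lies below every right end,
    whatever their indices. *)
Lemma nested_segments (u v : nat -> R) :
  (forall n, u n <= u n.+1) -> (forall n, v n.+1 <= v n) ->
  (forall n, u n <= v n) -> exists s, forall n, u n <= s <= v n.
Proof.
move=> uS vS uv.
have uhomo m n : (m <= n)%N -> u m <= u n 
  by apply: (@homo_leq _ u (fun x y => x <= y)) => // y x z; exact: le_trans.
have vhomo m n : (m <= n)%N -> v n <= v m.
  by apply: (@homo_leq _ v (fun x y => y <= x)) => // y x z xy yz; exact: le_trans yz xy.
have uvm m n : u m <= v n.
  by have [/uhomo/le_trans->//|/ltnW/vhomo] := leqP m n; apply: le_trans.
have ub : has_ubound (range u) by exists (v 0%N) => _ [n _ <-].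
exists (sup (range u)) => n; apply/andP; split; first by apply: ub_le_sup => //; exists n.
by apply: ge_sup; [exists (u 0%N); exists 0%N|move=> _ [m _ <-]].
Qed.

Lemma expr2_bound (S r : R) : 0 < r -> exists n, S / 2 ^+ n < r.
Proof.
move=> r0; exists (Num.bound `|S / r|).
rewrite ltr_pdivrMr ?exprn_gt0// mulrC -ltr_pdivrMr//.
apply: le_lt_trans (ler_norm _) _.
apply: (lt_trans (archi_boundP (normr_ge0 (S / r)))).
by rewrite -natrX ltr_nat ltn_expl.
Qed.

(* If N > e (width + height)^2 on a rectangle, the same holds on one of its four
   quarters; the nested rectangles so obtained contradict the local estimate at
   their common point. *)
Lemma bisection (N : R -> R -> R -> R -> R) (a b c d : R) :
  a <= b -> c <= d ->
  (forall a' b' c' d', a <= a' -> a' <= b' -> b' <= b ->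
     c <= c' -> c' <= d' -> d' <= d ->
     let m := (a' + b') / 2 in let n := (c' + d') / 2 in
     N a' b' c' d' <= N a' m c' n + N m b' c' n + N a' m n d' + N m b' n d') ->
  (forall s t, a <= s <= b -> c <= t <= d -> forall e, 0 < e ->
     exists2 r, 0 < r & forall a' b' c' d', a <= a' -> a' <= s -> s <= b' ->
       b' <= b -> c <= c' -> c' <= t -> t <= d' -> d' <= d ->
       (b' - a') + (d' - c') < r ->
       N a' b' c' d' <= e * ((b' - a') + (d' - c')) ^+ 2) ->
  N a b c d <= 0.
Proof.
move=> ab cd Nsub Nloc; rewrite leNgt; apply/negP => N0.
pose sz (q : R * R * R * R) := let: (a', b', c', d') := q in (b' - a') + (d' - c').
pose NN (q : R * R * R * R) := let: (a', b', c', d') := q in N a' b' c' d'.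
pose S := sz (a, b, c, d).
have S20 : 0 < S ^+ 2 + 1 by rewrite ltr_wpDl// sqr_ge0.
(* With this choice [e S^2 < N a b c d], so the initial rectangle is bad; the added 1 covers
   [S = 0]. *)
pose e := N a b c d / (S ^+ 2 + 1).
have e0 : 0 < e by rewrite divr_gt0.
pose bad q := e * sz q ^+ 2 < NN q.
(* The fourth quarter is taken untested. Each quarter has half the size, hence a quarter of the
   allowed bound, so if three of them respect it the last one must exceed it. *)
pose step (q : R * R * R * R) := let: (a', b', c', d') := q in
  let m := (a' + b') / 2 in let n := (c' + d') / 2 in
  if bad (a', m, c', n) then (a', m, c', n) else
  if bad (m, b', c', n) then (m, b', c', n) else
  if bad (a', m, n, d') then (a', m, n, d') else (m, b', n, d').
pose good (q : R * R * R * R) := let: (a', b', c', d') := q in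
  [/\ a <= a', a' <= b' & b' <= b] /\ [/\ c <= c', c' <= d' & d' <= d].
pose sub (q q' : R * R * R * R) :=
  let: (a', b', c', d') := q in let: (a'', b'', c'', d'') := q' in
  [/\ a' <= a'', b'' <= b', c' <= c'' & d'' <= d'].
have stepP q : good q -> bad q ->
    [/\ good (step q), bad (step q), sub q (step q) & sz (step q) = sz q / 2].
  case: q => [[[a' b'] c'] d'] [[aa' ab' bb'] [cc' cd' dd']] bq.
  have := Nsub a' b' c' d' aa' ab' bb' cc' cd' dd'; rewrite /step.
  set m := (a' + b') / 2; set n := (c' + d') / 2 => /= Nq.
  have am : a' <= m by rewrite /m; lra.
  have mb : m <= b' by rewrite /m; lra.
  have cn : c' <= n by rewrite /n; lra.
  have nd : n <= d' by rewrite /n; lra.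
  have [am2 mb2] : a <= m /\ m <= b by split; [exact: le_trans am|exact: le_trans bb'].
  have [cn2 nd2] : c <= n /\ n <= d by split; [exact: le_trans cn|exact: le_trans dd'].
  have szE : [/\ m - a' + (n - c') = (b' - a' + (d' - c')) / 2,
      b' - m + (n - c') = (b' - a' + (d' - c')) / 2,
      m - a' + (d' - n) = (b' - a' + (d' - c')) / 2
    & b' - m + (d' - n) = (b' - a' + (d' - c')) / 2].
    by split; rewrite /m /n; field.
  have [sz1 sz2 sz3 sz4] := szE.
  case: ifPn => [b1|b1]; first by [].
  case: ifPn => [b2|b2]; first by [].
  case: ifPn => [b3|b3]; first by [].
  split => //; move: bq b1 b2 b3; rewrite /bad /= -!leNgt sz1 sz2 sz3 sz4.
  rewrite expr_div_n; have -> : 2 ^+ 2 = 4 :> R by ring.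
  clear -Nq; lra.
pose Q n := iter n step (a, b, c, d).
have Q0 : good (Q 0%N) /\ bad (Q 0%N).
  split; first by split; split.
  by rewrite /bad /NN -/S /e mulrAC ltr_pdivrMr// ltr_pM2l// ltrDl ltr01.
have QP n : [/\ good (Q n), bad (Q n) & sz (Q n) = S / 2 ^+ n].
  elim: n => [|n [gn bn sn]]; first by case: Q0; rewrite expr0 divr1; split.
  have [g' b' _ s'] := stepP _ gn bn; split => //.
  by rewrite [LHS]s' sn exprS invfM mulrCA mulrC.
have QS n : sub (Q n) (Q n.+1).
  by have [gn bn _] := QP n; have [] := stepP _ gn bn.
pose u n := (Q n).1.1.1. pose v n := (Q n).1.1.2.
pose x n := (Q n).1.2. pose y n := (Q n).2.
have QE n : Q n = (u n, v n, x n, y n) by rewrite /u /v /x /y; case: (Q n) => [[[]]].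
have Qg n : good (u n, v n, x n, y n) by rewrite -QE; have [] := QP n.
have Qs n : sub (u n, v n, x n, y n) (u n.+1, v n.+1, x n.+1, y n.+1).
  by rewrite -!QE; exact: QS.
have [s sP] : exists s, forall n, u n <= s <= v n.
  by apply: nested_segments => n; [have [] := Qs n|have [] := Qs n|have [[]] := Qg n].
have [t tP] : exists t, forall n, x n <= t <= y n.
  by apply: nested_segments => n; [have [] := Qs n|have [] := Qs n|have [_ []] := Qg n].
have sab : a <= s <= b by exact: (sP 0%N).
have tcd : c <= t <= d by exact: (tP 0%N).
have [r r0 rP] := Nloc s t sab tcd e e0.
have [n nr] := expr2_bound S r0.
have [_ bn sn] := QP n; move: bn sn; rewrite /bad QE => bn sn.
have [[ga gab gb] [gc gcd gd]] := Qg n.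
have /andP[us sv] := sP n; have /andP[xt ty] := tP n.
have := rP (u n) (v n) (x n) (y n) ga us sv gb gc xt ty gd.
move: sn bn; rewrite /sz /NN => -> bn /(_ nr); lra.
Qed.

End Bisection.

(** * Boundary integrals over a parametrised rectangle *)

Section Goursat.
Variable R : realType.
Local Notation C := (R[i])^o.

Lemma path_deriv_eq (h : R -> C) t d d' : path_deriv h t d -> d = d' ->
  path_deriv h t d'.
Proof. by move=> hd <-. Qed.

Lemma path_lipschitz a b (h k : R -> C) M :
  (forall t, a <= t <= b -> path_deriv h t (k t)) -> ccont a b k ->
  (forall t, a <= t <= b -> cmod (k t) <= M) ->
  forall t u, a <= t <= b -> a <= u <= b -> cmod (h u - h t) <= 2 * M * `|u - t|.
Proof.
move=> hk kc kM.
have main t u : a <= t <= b -> a <= u <= b -> t <= u ->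
    cmod (h u - h t) <= 2 * M * (u - t).
  move=> /andP[at' tb] /andP[au ub] tu; rewrite -(@cint_FTC _ t u h k)//.
  - apply: cmod_cint_le_cst => //; first exact: ccont_sub kc _ _.
    by move=> s /andP[ts su]; apply: kM; rewrite (le_trans at')// (le_trans su).
  - exact: ccont_sub kc _ _.
  - by move=> s /andP[ts su]; apply: hk; rewrite (le_trans at')// (le_trans su).
move=> t u tab uab; have [tu|/ltW ut] := leP t u.
  by rewrite ger0_norm ?subr_ge0// main.
by rewrite cmodB ler0_norm ?subr_le0// opprB main.
Qed.

(** A primitive in [z] of the affine map [y + D (z - p)], which will be the tangent of f at p. *)
Definition affine_primitive (p y D z : C) : C :=
  y * z + D / 2 * ((z - p) * (z - p)).

(** The affine part integrates exactly, by its primitive, to a difference of end values; only the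
    remainder, at most [eta], has to be estimated. *)
Lemma path_integral_approx (f : C -> C) a b (h k : R -> C) M eta (p y D : C) :
  a <= b -> 0 <= eta ->
  (forall t, a <= t <= b -> path_deriv h t (k t)) -> ccont a b k ->
  (forall t, a <= t <= b -> cmod (k t) <= M) ->
  ccont a b (fun t => f (h t)) ->
  (forall t, a <= t <= b -> cmod (f (h t) - y - D * (h t - p)) <= eta) ->
  cmod (cint a b (fun t => f (h t) * k t) -
    (affine_primitive p y D (h b) - affine_primitive p y D (h a)))
    <= 2 * (eta * M) * (b - a).
Proof.
move=> ab eta0 hk kc kM fc fE; set L := affine_primitive p y D.
have hc : ccont a b h by exact: ccont_deriv hk.
have hpc : ccont a b (fun t => h t - p).
  exact: (ccontD hc (ccont_cst a b (- p))).
have lc : ccont a b (fun t => y + D * (h t - p)).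
  exact: (ccontD (ccont_cst a b y) (ccontM (ccont_cst a b D) hpc)).
have lkc : ccont a b (fun t => (y + D * (h t - p)) * k t) by exact: ccontM.
have fkc : ccont a b (fun t => f (h t) * k t) by exact: ccontM.
have LE : cint a b (fun t => (y + D * (h t - p)) * k t) = L (h b) - L (h a).
  apply: (@cint_FTC _ a b (fun t => L (h t))) => // t tab; rewrite /L /affine_primitive.
  have hp : path_deriv (fun u => h u - p) t (k t).
    apply: (path_deriv_eq (path_derivD (hk t tab) (path_deriv_cst (- p) t))).
    by rewrite addr0.
  apply: path_deriv_eq.
    apply: path_derivD.
      exact: path_derivM (path_deriv_cst y t) (hk t tab).
    exact: path_derivM (path_deriv_cst (D / 2) t) (path_derivM hp hp).
  rewrite !mul0r !addr0; by field.
rewrite -LE -cintB//; apply: cmod_cint_le_cst => //.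
  exact: (ccontD fkc (ccontN lkc)).
move=> t tab; rewrite -mulrBl opprD addrA cmodM.
by apply: ler_pM; rewrite ?cmod_ge0 ?fE ?kM.
Qed.

(** The boundary integral of the pulled-back form is additive over quarters, inner sides cancelling.
    Near a point, f is its tangent plus an error small against the distance. The tangent contributes
    nothing around a closed boundary, and the bounds on the partial derivatives of [Phi] turn the
    error into [e] times the square of the size. Bisection then applies to the modulus. *)
Theorem goursat_rectangle (f : C -> C) (Phi Phis Phit : R -> R -> C) a b c d M :
  a <= b -> c <= d ->
  (forall s t, a <= s <= b -> c <= t <= d ->
     path_deriv (fun s => Phi s t) s (Phis s t)) ->
  (forall s t, a <= s <= b -> c <= t <= d -> path_deriv (Phi s) t (Phit s t)) ->
  (forall t, c <= t <= d -> ccont a b (fun s => Phis s t)) ->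
  (forall s, a <= s <= b -> ccont c d (Phit s)) ->
  (forall s t, a <= s <= b -> c <= t <= d -> cmod (Phis s t) <= M) ->
  (forall s t, a <= s <= b -> c <= t <= d -> cmod (Phit s t) <= M) ->
  (forall s t, a <= s <= b -> c <= t <= d -> derivable f (Phi s t) 1) ->
  cint c d (fun t => f (Phi b t) * Phit b t) -
  cint c d (fun t => f (Phi a t) * Phit a t) =
  cint a b (fun s => f (Phi s d) * Phis s d) -
  cint a b (fun s => f (Phi s c) * Phis s c).
Proof.
move=> ab cd ds dt cs ct Ms Mt df.
pose V s c d := cint c d (fun t => f (Phi s t) * Phit s t).
pose H t a b := cint a b (fun s => f (Phi s t) * Phis s t).
pose I a b c d := V b c d - V a c d - H d a b + H c a b.
suff : cmod (I a b c d) <= 0.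
  rewrite le_eqVlt ltNge cmod_ge0 orbF cmod_eq0 /I /V /H => /eqP E.
  by apply/eqP; rewrite -subr_eq0 opprB addrA addrAC E.
have fs t : c <= t <= d -> ccont a b (fun s => f (Phi s t)).
  move=> tcd; apply: ccont_comp => [|s sab]; last exact: df.
  by apply: ccont_deriv => s sab; exact: ds.
have ft s : a <= s <= b -> ccont c d (fun t => f (Phi s t)).
  move=> sab; apply: ccont_comp => [|t tcd]; last exact: df.
  by apply: ccont_deriv => t tcd; exact: dt.
apply: (bisection (N := fun a b c d => cmod (I a b c d))) => //.
  move=> a' b' c' d' aa ab' bb cc cd' dd; cbv zeta.
  set m := (a' + b') / 2; set n := (c' + d') / 2.
  have [am mb] : a' <= m /\ m <= b' by rewrite /m; lra.
  have [cn nd] : c' <= n /\ n <= d' by rewrite /n; lra.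
  have VE s : a <= s <= b -> V s c' d' = V s c' n + V s n d'.
    move=> sab; apply: cint_chasles; first by rewrite cn nd.
    by apply: ccontM; [exact: ccont_sub (ft s sab) _ _|exact: ccont_sub (ct s sab) _ _].
  have HE t : c <= t <= d -> H t a' b' = H t a' m + H t m b'.
    move=> tcd; apply: cint_chasles; first by rewrite am mb.
    by apply: ccontM; [exact: ccont_sub (fs t tcd) _ _|exact: ccont_sub (cs t tcd) _ _].
  have -> : I a' b' c' d' = I a' m c' n + I m b' c' n + I a' m n d' + I m b' n d'.
    rewrite /I (VE b') ?(VE a') ?(HE c') ?(HE d'); first by ring.
    - by rewrite (le_trans cc)// (le_trans cn).
    - by rewrite cc (le_trans _ dd)// (le_trans cn).
    - by rewrite aa (le_trans _ bb)// (le_trans am).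
    - by rewrite bb (le_trans aa)// (le_trans am).
  by do 3 (apply: le_trans (cmodD _ _) _; rewrite lerD2r).
move=> s t sab tcd e e0.
have M0 : 0 <= M by apply: le_trans (Ms s t sab tcd); exact: cmod_ge0.
(* [M] may be 0, while the constants below divide by this bound. *)
pose M1 := M + 1.
have M10 : 0 < M1 by rewrite /M1 ltr_wpDl.
have [D /is_derive_littleoP fD] : exists D, is_derive (Phi s t) 1 f D.
  by exists ('D_1 f (Phi s t)); apply: DeriveDef => //; exact: df.
(* Each side of length l contributes at most [2 eta M1 l] with [eta = 2 e1 M1 S]. The four lengths
   add up to [2 S], which makes [8 e1 M1^2 S^2] in all. *)
pose e1 := e / (8 * M1 ^+ 2).
have e10 : 0 < e1 by rewrite divr_gt0// mulr_gt0// exprn_gt0.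
have e1C : 0 < e1%:C :> R[i] by rewrite ltcR.
have /near_cmodP[r r0 rP] := fD _ e1C.
exists (r / (2 * M1)); first by rewrite divr_gt0// mulr_gt0.
move=> a' b' c' d' aa as' sb bb cc ct' td dd szr.
set S := b' - a' + (d' - c').
have S0 : 0 <= S by rewrite /S; lra.
(* One parameter is moved at a time, along a path with Lipschitz constant [2 M]. *)
have near s' t' : a' <= s' <= b' -> c' <= t' <= d' ->
    cmod (Phi s' t' - Phi s t) <= 2 * M1 * S.
  move=> /andP[as2 sb2] /andP[ct2 td2].
  have s2 : a <= s' <= b by rewrite (le_trans aa as2) (le_trans sb2 bb).
  have t2 : c <= t' <= d by rewrite (le_trans cc ct2) (le_trans td2 dd).
  have L1 := path_lipschitz (fun s sab => ds s t' sab t2) (cs t' t2)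
    (fun s sab => Ms s t' sab t2) sab s2.
  have L2 := path_lipschitz (fun t tcd => dt s t sab tcd) (ct s sab)
    (fun t tcd => Mt s t sab tcd) tcd t2.
  have -> : Phi s' t' - Phi s t = (Phi s' t' - Phi s t') + (Phi s t' - Phi s t).
    by rewrite addrA subrK.
  apply: le_trans (cmodD _ _) _; apply: le_trans (lerD L1 L2) _.
  have sS : `|s' - s| <= b' - a' by rewrite ler_norml; lra.
  have tS : `|t' - t| <= d' - c' by rewrite ler_norml; lra.
  rewrite -mulrDr; apply: ler_pM; rewrite ?mulr_ge0 ?addr_ge0 ?normr_ge0//.
    by rewrite ler_pM2l// /M1 lerDl.
  exact: lerD.
pose eta := e1 * (2 * M1 * S).
have eta0 : 0 <= eta by apply: mulr_ge0; [exact: ltW|rewrite mulr_ge0// mulr_ge0// ltW].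
have fE s' t' : a' <= s' <= b' -> c' <= t' <= d' ->
    cmod (f (Phi s' t') - f (Phi s t) - D * (Phi s' t' - Phi s t)) <= eta.
  move=> s2 t2; have nst := near s' t' s2 t2.
  have /rP : cmod (Phi s' t' - Phi s t) < r.
    apply: le_lt_trans nst _; move: szr; rewrite -/S ltr_pdivlMr ?mulr_gt0//.
    by rewrite mulrC.
  rewrite !norm_cmod -rmorphM lecR => /le_trans; apply.
  by rewrite ler_pM2l.
pose L := affine_primitive (Phi s t) (f (Phi s t)) D.
have ab2 : a' <= b' by apply: (le_trans as').
have cd2 : c' <= d' by apply: (le_trans ct').
have VL s' : a' <= s' <= b' ->
    cmod (V s' c' d' - (L (Phi s' d') - L (Phi s' c'))) <= 2 * (eta * M1) * (d' - c').
  move=> s2; have s3 : a <= s' <= b.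
    by case/andP: s2 => ? ?; rewrite (le_trans aa)//= (le_trans _ bb).
  have sub u : c' <= u <= d' -> c <= u <= d.
    by case/andP=> ? ?; rewrite (le_trans cc)//= (le_trans _ dd).
  apply: path_integral_approx => //.
  - by move=> u /sub; exact: dt.
  - exact: ccont_sub (ct s' s3) _ _.
  - by move=> u /sub tu; rewrite (le_trans (Mt _ _ s3 tu))// /M1 lerDl.
  - exact: ccont_sub (ft s' s3) _ _.
  - by move=> u; exact: fE.
have HL t' : c' <= t' <= d' ->
    cmod (H t' a' b' - (L (Phi b' t') - L (Phi a' t'))) <= 2 * (eta * M1) * (b' - a').
  move=> t2; have t3 : c <= t' <= d.
    by case/andP: t2 => ? ?; rewrite (le_trans cc)//= (le_trans _ dd).
  have sub u : a' <= u <= b' -> a <= u <= b.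
    by case/andP=> ? ?; rewrite (le_trans aa)//= (le_trans _ bb).
  apply: (path_integral_approx (h := fun s => Phi s t')) => //.
  - by move=> u /sub us; exact: ds.
  - exact: ccont_sub (cs t' t3) _ _.
  - by move=> u /sub tu; rewrite (le_trans (Ms _ _ tu t3))// /M1 lerDl.
  - exact: ccont_sub (fs t' t3) _ _.
  - by move=> u u2; exact: fE.
(* Each corner value of [L] occurs twice with opposite signs, so subtracting the primitive on every
   side changes nothing. *)
have -> : I a' b' c' d' =
    (V b' c' d' - (L (Phi b' d') - L (Phi b' c'))) -
    (V a' c' d' - (L (Phi a' d') - L (Phi a' c'))) -
    (H d' a' b' - (L (Phi b' d') - L (Phi a' d'))) +
    (H c' a' b' - (L (Phi b' c') - L (Phi a' c'))).
  by rewrite /I; ring.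
apply: le_trans (cmodD _ _) _.
have -> : e * S ^+ 2 =
    2 * (eta * M1) * (d' - c') + 2 * (eta * M1) * (d' - c') +
    2 * (eta * M1) * (b' - a') + 2 * (eta * M1) * (b' - a').
  by rewrite /eta /e1 /S; field; rewrite gt_eqF.
apply: lerD; last by apply: HL; rewrite lexx.
apply: le_trans (cmodD _ _) _; apply: lerD; last first.
  by rewrite cmodN; apply: HL; rewrite lexx andbT.
apply: le_trans (cmodD _ _) _; apply: lerD; last first.
  by rewrite cmodN; apply: VL; rewrite lexx.
by apply: VL; rewrite lexx andbT.
Qed.

End Goursat.

(** * Cauchy's formula *)

Section Cauchy.
Variable R : realType.
Local Notation C := (R[i])^o.
Local Notation tau := (2 * pi : R).

(** Strictness survives at both ends of the range of [s]. Applied to opposites, it also yields the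
    positive lower bounds for the moving circle. *)
Lemma convex_comb_lt (s x y k : R) : 0 <= s <= 1 -> x < k -> y < k ->
  (1 - s) * x + s * y < k.
Proof.
move=> /andP[s0 s1] xk yk; have [->|sN1] := eqVneq s 1.
  by rewrite subrr mul0r mul1r add0r.
have s1' : 0 < 1 - s by rewrite subr_gt0 lt_neqAle sN1.
have : (1 - s) * x < (1 - s) * k by rewrite ltr_pM2l.
have : s * y <= s * k by rewrite ler_wpM2l// ltW.
lra.
Qed.

Lemma tau_gt0 : 0 < tau. Proof. by rewrite mulr_gt0// pi_gt0. Qed.

Lemma expi0 : expi (0 : R) = 1 :> C.
Proof. by rewrite /expi cos0 sin0. Qed.

Lemma expi_tau : expi tau = 1 :> C.
Proof. by rewrite /expi mulr_natl cos2pi sin2pi. Qed.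

Lemma expi_neq0 t : expi t != 0 :> C.
Proof. by rewrite -cmod_gt0 cmod_expi. Qed.

Lemma ccont_expi a b : ccont a b (@expi R).
Proof. by apply: ccont_deriv => t _; exact: path_deriv_expi. Qed.

Lemma cderivE (f : C -> C) (z d : C) : is_derive z 1 f d -> cderiv f z = d.
Proof. by case=> _ <-; rewrite /cderiv derive1E. Qed.

Lemma is_cderiv (f : C -> C) (z : C) : derivable f z 1 -> is_derive z 1 f (cderiv f z).
Proof. by move=> df; apply: DeriveDef; [exact: df|rewrite /cderiv derive1E]. Qed.

Lemma near_disc (z : C) (r : R) : cmod z < r -> \forall w \near z, cmod w < r.
Proof.
move=> zr; apply/(near_cmodP z (fun w => cmod w < r)).
exists (r - cmod z); first by rewrite subr_gt0.
by move=> w wz; have := cmodD (w - z) z; rewrite subrK; lra.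
Qed.

Lemma cint_cst a b (z : C) : a <= b -> cint a b (fun=> z) = (b - a)%:C * z.
Proof.
move=> ab; rewrite (@cint_FTC _ a b (fun t => t%:C * z))//.
- by rewrite -mulrBl -rmorphB.
- exact: ccont_cst.
- move=> t _; apply: path_deriv_eq.
    exact: path_derivM (path_deriv_real t) (path_deriv_cst z t).
  by rewrite mulr0 add0r mul1r.
Qed.

Lemma derivable_cauchy_kernel (f : C -> C) (z w : C) : w != z ->
  derivable f w 1 -> derivable (fun w => f w * (w - z)^-1) w 1.
Proof.
move=> wz df; apply: (@derivableM _ _ f (fun w => (w - z)^-1)); first exact: df.
apply: (@derivableV _ _ (fun w : C => w - z)); first by rewrite subr_eq0.
apply: derivableB; [exact: derivable_id|exact: derivable_cst].
Qed.

(* The circle |w| = r is shrunk to |w - z| = rho by moving its centre to z. *)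
Lemma cauchy_shrink (f : C -> C) r rho (z : C) : analytic_disc f ->
  r < 1 -> cmod z < r -> 0 < rho -> cmod z + rho < 1 ->
  cint 0 tau (fun t => f (r%:C * expi t) * (r%:C * expi t / (r%:C * expi t - z))) =
  cint 0 tau (fun t => f (z + rho%:C * expi t)).
Proof.
move=> fa r1 zr rho0 zrho.
have z0 := cmod_ge0 z.
(* [al] is the small circle and [al + be] the circle of radius r about 0. The intermediate curve is
   the circle of centre [(1 - s) z] and radius [rho + s (r - rho)]. *)
pose al t : C := z + rho%:C * expi t.
pose be t : C := (r - rho)%:C * expi t - z.
pose Phi s t : C := al t + s%:C * be t.
pose Phit s t : C := rho%:C * ('i * expi t) + s%:C * ((r - rho)%:C * ('i * expi t)).
have PhiE s t : Phi s t = (1 - s)%:C * z + (rho + s * (r - rho))%:C * expi t.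
  by rewrite /Phi /al /be !(rmorphD, rmorphB, rmorphM, rmorph1) /=; ring.
have PhitE s t : Phit s t = (rho + s * (r - rho))%:C * ('i * expi t).
  by rewrite /Phit !(rmorphD, rmorphB, rmorphM) /=; ring.
have r0 : 0 < r by exact: le_lt_trans zr.
have rad0 s : 0 <= s <= 1 -> 0 < rho + s * (r - rho) <= 1.
  move=> s01; have -> : rho + s * (r - rho) = (1 - s) * rho + s * r by ring.
  apply/andP; split; last by rewrite ltW// convex_comb_lt//; lra.
  have := @convex_comb_lt s (- rho) (- r) 0 s01; rewrite !oppr_lt0.
  by move=> /(_ rho0 r0); rewrite !mulrN -opprD oppr_lt0.
have Phi1 s t : 0 <= s <= 1 -> cmod (Phi s t) < 1.
  move=> s01; rewrite PhiE; apply: le_lt_trans (cmodD _ _) _.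
  have /andP[ra _] := rad0 s s01; have /andP[_ s1] := s01.
  rewrite !cmodM !cmod_real cmod_expi mulr1 (gtr0_norm ra) ger0_norm ?subr_ge0//.
  by have := convex_comb_lt s01 zrho r1; lra.
(* The distance to z is at least [(1 - s) rho + s (r - |z|)], a combination of two positive
   numbers. *)
have Phiz s t : 0 <= s <= 1 -> Phi s t != z.
  move=> s01; rewrite -subr_eq0 -cmod_gt0.
  have /andP[ra _] := rad0 s s01; have /andP[s0 _] := s01.
  have -> : Phi s t - z = (rho + s * (r - rho))%:C * expi t - s%:C * z.
    by rewrite PhiE !(rmorphD, rmorphB, rmorphM, rmorph1) /=; ring.
  have := cmodD ((rho + s * (r - rho))%:C * expi t - s%:C * z) (s%:C * z).
  rewrite subrK !cmodM !cmod_real cmod_expi mulr1 (gtr0_norm ra) ger0_norm//.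
  have zr' : cmod z - r < 0 by lra.
  by have := @convex_comb_lt s (- rho) _ 0 s01 _ zr'; rewrite oppr_lt0 => /(_ rho0); lra.
have dPs s t : path_deriv (fun s => Phi s t) s (be t).
  apply: path_deriv_eq.
    apply: path_derivD; first exact: path_deriv_cst.
    exact: path_derivM (path_deriv_real s) (path_deriv_cst (be t) s).
  by rewrite mulr0 !add0r mul1r.
have dPt s t : path_deriv (Phi s) t (Phit s t).
  have E k : path_deriv (fun u => k%:C * expi u) t (k%:C * ('i * expi t)).
    apply: path_deriv_eq.
      exact: path_derivM (path_deriv_cst k%:C t) (path_deriv_expi t).
    by rewrite mul0r addr0.
  apply: path_deriv_eq.
    apply: path_derivD; first exact: path_derivD (path_deriv_cst z t) (E rho).
    apply: path_derivM (path_deriv_cst s%:C t) _.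
    exact: path_derivD (E (r - rho)) (path_deriv_cst (- z) t).
  by rewrite /Phit mul0r !addr0 add0r.
have ct s : ccont 0 tau (Phit s).
  have E k : ccont 0 tau (fun u => k%:C * ('i * expi u)).
    exact: (ccontM (ccont_cst _ _ _) (ccontM (ccont_cst _ _ _) (ccont_expi _ _))).
  exact: (ccontD (E rho) (ccontM (ccont_cst _ _ _) (E (r - rho)))).
have i1 := @cmod_i R.
have G := @goursat_rectangle R (fun w => f w * (w - z)^-1) Phi (fun _ => be) Phit
  0 1 0 tau 3.
have {}G := G ler01 (ltW tau_gt0) (fun s t _ _ => dPs s t) (fun s t _ _ => dPt s t)
  (fun t _ => ccont_cst _ _ (be t)) (fun s _ => ct s).
have : cint 0 tau (fun t => f (Phi 1 t) * (Phi 1 t - z)^-1 * Phit 1 t) -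
       cint 0 tau (fun t => f (Phi 0 t) * (Phi 0 t - z)^-1 * Phit 0 t) = 0.
  rewrite G.
  (* The sides [t = 0] and [t = tau] coincide by periodicity and cancel. *)
  - by rewrite /Phi /al /be expi0 expi_tau subrr.
  - move=> s t _ _; rewrite /be; apply: le_trans (cmodD _ _) _.
    rewrite cmodN cmodM cmod_real cmod_expi mulr1.
    have : `|r - rho| <= 1 by rewrite ler_norml; lra.
    lra.
  - move=> s t s01 _; rewrite PhitE !cmodM i1 cmod_expi cmod_real !mulr1.
    have /andP[ra rb] := rad0 s s01; rewrite gtr0_norm//; lra.
  - move=> s t s01 _; apply: derivable_cauchy_kernel; first exact: Phiz.
    by apply: fa; exact: Phi1.
have in01 (s : R) : s = 0 \/ s = 1 -> 0 <= s <= 1 by case=> ->; rewrite ?lexx ler01.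
have fc s : s = 0 \/ s = 1 -> ccont 0 tau (fun t => f (Phi s t)).
  move=> /in01 s01; apply: ccont_comp => [|t _]; last by apply: fa; exact: Phi1.
  by apply: ccont_deriv => t _; exact: dPt.
have Phi1E t : Phi 1 t = r%:C * expi t.
  by rewrite PhiE subrr mul0r add0r mul1r addrC subrK.
have Phi0E t : Phi 0 t = z + rho%:C * expi t.
  by rewrite PhiE subr0 mul1r mul0r addr0.
have c1 : ccont 0 tau (fun t => f (r%:C * expi t) * (r%:C * expi t / (r%:C * expi t - z))).
  have ec : ccont 0 tau (fun t => r%:C * expi t).
    exact: (ccontM (ccont_cst _ _ _) (ccont_expi _ _)).
  have fc1 := fc 1 (or_intror erefl).
  apply: ccontM; first by under eq_fun do rewrite -Phi1E.
  apply: ccontM => //; apply: ccontV.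
    by move=> t _; rewrite subr_eq0 -Phi1E Phiz// ler01 lexx.
  exact: (ccontD ec (ccont_cst _ _ _)).
have c0 : ccont 0 tau (fun t => f (z + rho%:C * expi t)).
  by under eq_fun do rewrite -Phi0E; apply: fc; left.
(* On each of the two circles dw is ['i] times (w minus the centre) dt. The common factor ['i] is
   cancelled at the end; on the small circle the rest cancels the kernel. *)
rewrite (@eq_cint _ 0 tau _ (fun t => 'i *
  (f (r%:C * expi t) * (r%:C * expi t / (r%:C * expi t - z))))); last first.
  by move=> t _; rewrite Phi1E PhitE mul1r [rho + _]addrC subrK; ring.
rewrite (@eq_cint _ 0 tau (fun t => f (Phi 0 t) * _ * _)
   (fun t => 'i * f (z + rho%:C * expi t))); last first.
  move=> t _; rewrite Phi0E PhitE mul0r addr0 addrAC subrr add0r; field.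
  by rewrite expi_neq0 -cmod_gt0 [cmod _]cmod_real normr_gt0 gt_eqF.
rewrite !cintZ// -mulrBr => /eqP; rewrite mulf_eq0 => /orP[|].
  by rewrite -cmod_eq0 i1 oner_eq0.
by rewrite subr_eq0 => /eqP.
Qed.

End Cauchy.

(** * The formula for f(z), the mean value property, and differentiation under the integral *)

Section CauchyConsequences.
Variable R : realType.
Local Notation C := (R[i])^o.
Local Notation tau := (2 * pi : R).

Lemma near_derivable_cvg (f : C -> C) (z : C) : derivable f z 1 ->
  forall e : R, 0 < e -> exists2 r : R, 0 < r &
    forall w, cmod (w - z) < r -> cmod (f w - f z) < e.
Proof.
move=> /derivable1_diffP/differentiable_continuous fc e e0.
have eC : 0 < e%:C :> R[i] by rewrite ltcR.
have FF : Filter (nbhs (z : C)) by exact: nbhs_filter.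
have /cvgrPdist_lt/(_ _ eC)/near_cmodP[r r0 rP] := fc.
by exists r => // w /rP; rewrite norm_cmod ltcR cmodB.
Qed.

(** Shrinking leaves the integral of f over a circle about z whose radius is at will. Continuity of
    f at z makes it as close to [tau f(z)] as desired, and both sides are independent of that
    radius. *)
Lemma cauchy_formula (f : C -> C) r (z : C) : analytic_disc f ->
  r < 1 -> cmod z < r ->
  cint 0 tau (fun t => f (r%:C * expi t) * (r%:C * expi t / (r%:C * expi t - z))) =
  tau%:C * f z.
Proof.
move=> fa r1 zr; set A := cint _ _ _.
have z1 : cmod z < 1 by exact: lt_trans r1.
apply/eqP; rewrite -subr_eq0 -cmod_eq0 eq_le cmod_ge0 andbT.
apply/ler_addgt0Pl => e e0; rewrite addr0.
have t0 : 0 < tau by exact: tau_gt0.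
have e1 : 0 < e / (2 * tau) by rewrite divr_gt0// mulr_gt0.
have [d d0 dP] := near_derivable_cvg (fa z z1) e1.
pose rho := Num.min (d / 2) ((1 - cmod z) / 2).
have rho0 : 0 < rho by rewrite lt_min !divr_gt0// subr_gt0.
have rhod : rho < d by rewrite /rho gt_min; apply/orP; left; lra.
have rhoz : cmod z + rho < 1.
  have : rho <= (1 - cmod z) / 2 by rewrite ge_min lexx orbT.
  by lra.
rewrite /A (@cauchy_shrink R f r rho z)//.
have pc t : cmod (z + rho%:C * expi t) < 1.
  apply: le_lt_trans (cmodD _ _) _; rewrite cmodM cmod_expi cmod_real mulr1.
  by rewrite gtr0_norm.
have fc : ccont 0 tau (fun t => f (z + rho%:C * expi t)).
  apply: ccont_comp => [|t _]; last exact: fa.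
  exact: (ccontD (ccont_cst _ _ _) (ccontM (ccont_cst _ _ _) (ccont_expi _ _))).
have -> : tau%:C * f z = cint 0 tau (fun=> f z) by rewrite cint_cst ?subr0 ?ltW.
rewrite -cintB//; last exact: ccont_cst.
have -> : e = 2 * (e / (2 * tau)) * (tau - 0).
  by rewrite subr0; move: (tau) (t0) => T T0; field; rewrite gt_eqF.
apply: cmod_cint_le_cst => [||t _]; first exact: ltW.
  exact: (ccontD fc (ccontN (ccont_cst _ _ _))).
apply/ltW/dP; rewrite addrAC subrr add0r cmodM cmod_expi cmod_real mulr1.
by rewrite gtr0_norm.
Qed.

Lemma mean_value (f : C -> C) r : analytic_disc f -> 0 < r < 1 ->
  cint 0 tau (fun t => f (r%:C * expi t)) = tau%:C * f 0.
Proof.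
move=> fa /andP[r0 r1]; rewrite -(@cauchy_formula f r)// ?cmod0//.
apply: eq_cint => t _; rewrite subr0 divff ?mulr1//.
by rewrite mulf_eq0 negb_or expi_neq0 -cmod_gt0 [cmod _]cmod_real normr_gt0 gt_eqF.
Qed.

(** A remainder quadratic in [w - z], uniformly in [t], survives integration and is still little-o;
    no convergence theorem is involved. *)
Lemma cint_is_derive a b (K : C -> R -> C) (K' : R -> C) (z : C) r M :
  a <= b -> 0 < r ->
  (forall w, cmod (w - z) < r -> ccont a b (K w)) -> ccont a b K' ->
  (forall w t, cmod (w - z) < r -> a <= t <= b ->
     cmod (K w t - K z t - K' t * (w - z)) <= M * cmod (w - z) ^+ 2) ->
  is_derive z 1 (fun w => cint a b (K w)) (cint a b K').
Proof.
move=> ab r0 Kc K'c KM; apply/is_derive_littleoP => -[e1 e2] e0.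
have e10 : 0 < e1 by move: e0; rewrite ltcE /= => /andP[_].
have {e0} -> : e2 = 0 by move: e0; rewrite ltcE /= => /andP[/eqP].
(* The integrated remainder is at most [(B - 1) |w - z|^2]; the added 1 makes [B] a legitimate
   divisor. *)
pose B := 2 * `|M| * (b - a) + 1.
have B0 : 0 < B by rewrite /B ltr_wpDl// !mulr_ge0// subr_ge0.
apply/(near_cmodP z (fun w => `|cint a b (K w) - cint a b (K z) -
  cint a b K' * (w - z)| <= e1%:C * `|w - z|)).
exists (Num.min r (e1 / B)); first by rewrite lt_min r0 divr_gt0.
move=> w; rewrite lt_min => /andP[wr we].
rewrite !norm_cmod -rmorphM lecR.
have zz : cmod (z - z) < r by rewrite subrr cmod0.
have KzC := Kc z zz; have KwC := Kc w wr.
have dC : ccont a b (fun t => K w t - K z t) by exact: (ccontD KwC (ccontN KzC)).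
have pC : ccont a b (fun t => (w - z) * K' t).
  exact: (ccontM (ccont_cst _ _ _) K'c).
rewrite [cint a b K' * _]mulrC -(cintZ _ K'c) -(cintB KwC KzC) -(cintB dC pC).
apply: (@le_trans _ _ (2 * (`|M| * cmod (w - z) ^+ 2) * (b - a))).
  apply: cmod_cint_le_cst => //; first exact: (ccontD dC (ccontN pC)).
  move=> t tab; rewrite [_ * K' t]mulrC; apply: le_trans (KM w t wr tab) _.
  by rewrite ler_wpM2r ?sqr_ge0// ler_norm.
have w0 := cmod_ge0 (w - z).
apply: (@le_trans _ _ (B * cmod (w - z) * cmod (w - z))).
  have -> : 2 * (`|M| * cmod (w - z) ^+ 2) * (b - a) =
    (B - 1) * cmod (w - z) * cmod (w - z) by rewrite /B; ring.
  by rewrite !ler_wpM2r// gerBl.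
by rewrite ler_wpM2r// mulrC -ler_pdivlMr// ltW.
Qed.

Lemma ccont_bounded a b (h : R -> C) : a <= b -> ccont a b h ->
  exists M, forall t, a <= t <= b -> cmod (h t) <= M.
Proof.
move=> ab hc.
have [|c _ cP] := @EVT_max R (fun t => cmod (h t)) a b ab.
  by apply: continuous_in_subspaceT => t; rewrite inE /= in_itv /= => /(ccont_cmod hc).
by exists (cmod (h c)) => t tab; apply: cP; rewrite in_itv.
Qed.

(** * Differentiating Cauchy transforms in the pole *)

Section CauchyTransform.
Variables (a b r : R) (c w : R -> C) (z : C).
Hypotheses (ab : a <= b) (cc : ccont a b c) (wc : ccont a b w) (r0 : 0 < r).
Hypothesis wz : forall t, a <= t <= b -> 2 * r <= cmod (w t - z).

Let wz_near t v : cmod (v - z) < r -> a <= t <= b -> r <= cmod (w t - v).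
Proof.
move=> vr tab; have := cmodD (w t - v) (v - z).
by rewrite addrA subrK; have := wz tab; lra.
Qed.

Let wz_neq0 t v : cmod (v - z) < r -> a <= t <= b -> w t - v != 0.
Proof. by move=> vr tab; rewrite -cmod_gt0 (lt_le_trans r0)// wz_near. Qed.

Let zz : cmod (z - z) < r. Proof. by rewrite subrr cmod0. Qed.

Let kernel_cont v : cmod (v - z) < r -> ccont a b (fun t => (w t - v)^-1).
Proof.
move=> vr; apply: ccontV => [t tab|]; first exact: wz_neq0.
exact: (ccontD wc (ccont_cst a b (- v))).
Qed.

Let inv_le t v : cmod (v - z) < r -> a <= t <= b -> cmod (w t - v)^-1 <= r^-1.
Proof.
move=> vr tab; rewrite cmodV lef_pV2 ?posrE//; first exact: wz_near.
by rewrite (lt_le_trans r0)// wz_near.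
Qed.

(** The remainder is exactly [c (v - z)^2 / ((w - z)^2 (w - v))]. Since the path stays at distance
    [2 r] from z, it stays at distance r from every v within r of z, which bounds each inverse by
    [r^-1]. *)
Lemma cauchy_transform1 :
  is_derive z 1 (fun v => cint a b (fun t => c t * (w t - v)^-1))
    (cint a b (fun t => c t * ((w t - z)^-1 * (w t - z)^-1))).
Proof.
have [M cM] := ccont_bounded ab cc.
apply: (@cint_is_derive a b (fun v t => c t * (w t - v)^-1) _ z r
  (M * (r^-1 * r^-1 * r^-1))) => //.
- by move=> v vr; exact: (ccontM cc (kernel_cont vr)).
- exact: (ccontM cc (ccontM (kernel_cont zz) (kernel_cont zz))).
move=> v t vr tab.
have x0 := wz_neq0 zz tab; have y0 := wz_neq0 vr tab.
have -> : c t / (w t - v) - c t / (w t - z) -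
    c t * ((w t - z)^-1 * (w t - z)^-1) * (v - z) =
    c t * ((w t - z)^-1 * (w t - z)^-1 * (w t - v)^-1) * ((v - z) * (v - z)).
  by field; rewrite x0 y0.
rewrite !cmodM -expr2 ler_wpM2r ?sqr_ge0//.
have rV0 : 0 <= r^-1 by rewrite invr_ge0 ltW.
apply: ler_pM; rewrite ?cM ?mulr_ge0 ?cmod_ge0//.
apply: ler_pM; rewrite ?inv_le ?mulr_ge0 ?cmod_ge0//.
by apply: ler_pM; rewrite ?inv_le ?cmod_ge0.
Qed.

(** This second derivative is what makes f' differentiable. Here the remainder carries the extra
    factor [1 / (w - v) + 2 / (w - z)], bounded by [3 r^-1]. *)
Lemma cauchy_transform2 :
  is_derive z 1 (fun v => cint a b (fun t => c t * ((w t - v)^-1 * (w t - v)^-1)))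
    (cint a b (fun t => c t * (2 * ((w t - z)^-1 * (w t - z)^-1 * (w t - z)^-1)))).
Proof.
have [M cM] := ccont_bounded ab cc.
apply: (@cint_is_derive a b (fun v t => c t * ((w t - v)^-1 * (w t - v)^-1)) _ z r
  (M * (r^-1 * r^-1 * r^-1 * (3 * r^-1)))) => //.
- by move=> v vr; exact: (ccontM cc (ccontM (kernel_cont vr) (kernel_cont vr))).
- exact: (ccontM cc (ccontM (ccont_cst _ _ _)
    (ccontM (ccontM (kernel_cont zz) (kernel_cont zz)) (kernel_cont zz)))).
move=> v t vr tab.
have x0 := wz_neq0 zz tab; have y0 := wz_neq0 vr tab.
have -> : c t * ((w t - v)^-1 * (w t - v)^-1) - c t * ((w t - z)^-1 * (w t - z)^-1) -
    c t * (2 * ((w t - z)^-1 * (w t - z)^-1 * (w t - z)^-1)) * (v - z) =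
    c t * ((w t - z)^-1 * (w t - z)^-1 * (w t - v)^-1 *
      ((w t - v)^-1 + 2 * (w t - z)^-1)) * ((v - z) * (v - z)).
  by field; rewrite x0 y0.
rewrite !cmodM -expr2 ler_wpM2r ?sqr_ge0//.
have rV0 : 0 <= r^-1 by rewrite invr_ge0 ltW.
apply: ler_pM; rewrite ?cM ?mulr_ge0 ?cmod_ge0//.
apply: ler_pM; rewrite ?inv_le ?mulr_ge0 ?cmod_ge0//.
  apply: ler_pM; rewrite ?inv_le ?mulr_ge0 ?cmod_ge0//.
  by apply: ler_pM; rewrite ?inv_le ?cmod_ge0.
apply: le_trans (cmodD _ _) _; rewrite cmodM.
have -> : cmod (2 : C) = 2.
  by rewrite -[2 : C](rmorph_nat (real_complex R)) [cmod _]cmod_real ger0_norm.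
by have := inv_le vr tab; have := inv_le zz tab; lra.
Qed.

End CauchyTransform.

End CauchyConsequences.

(** * Analyticity of the derivative and primitives along rays *)

Section Analytic.
Variable R : realType.
Local Notation C := (R[i])^o.
Local Notation tau := (2 * pi : R).

Lemma is_derive_Mc (F : C -> C) (k v d : C) :
  is_derive v 1 F d -> is_derive v 1 (fun w => k * F w) (k * d).
Proof. by move=> Fd; exact: (@is_deriveZ _ _ _ F k v 1 d Fd). Qed.

Lemma is_derive_eq_disc (f g : C -> C) (z d : C) (r : R) : cmod z < r ->
  (forall w, cmod w < r -> f w = g w) -> is_derive z 1 f d -> is_derive z 1 g d.
Proof.
move=> zr fg; apply: near_eq_is_derive; apply: filterS (near_disc zr) => w.
exact: fg.
Qed.

(** On a disc of radius r strictly between |z| and 1, Cauchy's formula writes f as a Cauchy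
    transform of its values on the circle, and such a transform can be differentiated twice. *)
Lemma analytic_cderiv (f : C -> C) : analytic_disc f -> analytic_disc (cderiv f).
Proof.
move=> fa z z1.
pose r : R := (1 + cmod z) / 2.
have zr : cmod z < r by rewrite /r; lra.
have r1 : r < 1 by rewrite /r; lra.
have r0 : 0 < r by exact: le_lt_trans (cmod_ge0 z) zr.
pose w t : C := r%:C * expi t.
pose c t : C := f (w t) * w t.
have t0 : 0 <= tau by exact/ltW/tau_gt0.
have wE t : cmod (w t) = r by rewrite cmodM cmod_expi cmod_real mulr1 gtr0_norm.
have wc : ccont 0 tau w by exact: (ccontM (ccont_cst _ _ _) (ccont_expi _ _)).
have cc : ccont 0 tau c.
  apply: ccontM => //; apply: ccont_comp => // t _; apply: fa; by rewrite wE.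
have rv v : cmod v < r -> 0 < (r - cmod v) / 2.
  by move=> vr; rewrite divr_gt0// subr_gt0.
have wv v t : 2 * ((r - cmod v) / 2) <= cmod (w t - v).
  by have := cmodD (w t - v) v; rewrite subrK wE; lra.
have tauC : tau%:C != 0 :> C.
  by rewrite -cmod_gt0 [cmod _]cmod_real normr_gt0 gt_eqF// tau_gt0.
pose F1 v := cint 0 tau (fun t => c t * (w t - v)^-1).
pose F2 v := cint 0 tau (fun t => c t * ((w t - v)^-1 * (w t - v)^-1)).
have fE v : cmod v < r -> tau%:C^-1 * F1 v = f v.
  move=> vr; rewrite -[RHS](mulKf tauC) -(@cauchy_formula _ f r v)//.
  by congr (_ * _); apply: eq_cint => t _; rewrite mulrA.
(* The identification is needed on the whole disc of radius r: the derivative of f' at z depends on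
   f' near z. *)
have f'E v : cmod v < r -> tau%:C^-1 * F2 v = cderiv f v.
  move=> vr; apply/esym/cderivE.
  have D1 : is_derive v 1 F1 (F2 v).
    by apply: (@cauchy_transform1 _ _ _ _ c w v t0 cc wc (rv v vr)) => t _.
  exact: (is_derive_eq_disc vr fE (is_derive_Mc (tau%:C^-1) D1)).
have D2 := @cauchy_transform2 _ _ _ _ c w z t0 cc wc (rv z zr) (fun t _ => wv z t).
have [] // : is_derive z 1 (cderiv f) (tau%:C^-1 * cint 0 tau (fun t =>
   c t * (2 * ((w t - z)^-1 * (w t - z)^-1 * (w t - z)^-1)))).
exact: (is_derive_eq_disc zr f'E (is_derive_Mc (tau%:C^-1) D2)).
Qed.

Lemma cmod_segment (z w : C) t r : 0 <= t <= 1 -> cmod z < r -> cmod w < r ->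
  cmod (z + t%:C * (w - z)) < r.
Proof.
move=> t01 zr wr; have := convex_comb_lt t01 zr wr; apply: le_lt_trans.
have -> : z + t%:C * (w - z) = (1 - t)%:C * z + t%:C * w.
  by rewrite rmorphB rmorph1; ring.
case/andP: t01 => t0 t1.
apply: le_trans (cmodD _ _) _; rewrite !cmodM !cmod_real.
by rewrite !ger0_norm ?subr_ge0.
Qed.

Lemma cmod_scale_lt1 (z : C) t : 0 <= t <= 1 -> cmod z < 1 -> cmod (t%:C * z) < 1.
Proof.
move=> t01 z1; have := @cmod_segment 0 z t 1 t01; rewrite cmod0 add0r subr0; exact.
Qed.

Lemma path_deriv_segment (z w : C) t : path_deriv (fun t => z + t%:C * w) t w.
Proof.
apply: path_deriv_eq.
  apply: path_derivD; first exact: path_deriv_cst.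
  exact: path_derivM (path_deriv_real t) (path_deriv_cst w t).
by rewrite mulr0 !add0r mul1r.
Qed.

Lemma path_deriv_ray (w : C) t : path_deriv (fun t => t%:C * w) t w.
Proof.
have := path_deriv_segment 0 w t.
by under eq_fun do rewrite add0r.
Qed.

Lemma ccont_segment a b (z w : C) : ccont a b (fun t => z + t%:C * w).
Proof. by apply: ccont_deriv => t _; exact: path_deriv_segment. Qed.

Lemma ccont_ray a b (w : C) : ccont a b (fun t => t%:C * w).
Proof. by apply: ccont_deriv => t _; exact: path_deriv_ray. Qed.

Lemma cint_ray_cderiv (f : C -> C) (z : C) : analytic_disc f -> cmod z < 1 ->
  cint 0 1 (fun t => cderiv f (t%:C * z) * z) = f z - f 0.
Proof.
move=> fa z1; have f'a := analytic_cderiv fa.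
rewrite (@cint_FTC _ 0 1 (fun t => f (t%:C * z)))//.
- by rewrite mul0r mul1r.
- apply: ccontM; last exact: ccont_cst.
  apply: ccont_comp; first exact: ccont_ray.
  by move=> t t01; apply: f'a; exact: cmod_scale_lt1.
- move=> t t01; apply: path_deriv_comp; last exact: path_deriv_ray.
  by apply: is_cderiv; apply: fa; exact: cmod_scale_lt1.
Qed.

(** The integral of f along the segment from 0 to z; [Tg g f] is the case of the product of f and
    g'. *)
Definition ray_primitive (f : C -> C) (z : C) : C := cint 0 1 (fun t => f (t%:C * z) * z).

(** Goursat on the triangle with vertices 0, z, w, parametrised as a square with one side collapsed
    to the origin: two sides are the rays to z and w, the remaining one is the segment between
    them. *)
Lemma ray_primitive_diff (f : C -> C) (z w : C) : analytic_disc f ->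
  cmod z < 1 -> cmod w < 1 ->
  ray_primitive f w - ray_primitive f z =
  cint 0 1 (fun s => f (z + s%:C * (w - z)) * (w - z)).
Proof.
move=> fa z1 w1.
pose Phi s t : C := t%:C * z + s%:C * (t%:C * (w - z)).
have PhiE s t : Phi s t = t%:C * (z + s%:C * (w - z)) by rewrite /Phi; ring.
have h2 : cmod (w - z) <= 2.
  by apply: le_trans (cmodD _ _) _; rewrite cmodN; lra.
have := @goursat_rectangle R f Phi (fun _ t => t%:C * (w - z))
  (fun s _ => z + s%:C * (w - z)) 0 1 0 1 2 ler01 ler01.
rewrite /ray_primitive.
have -> : cint 0 1 (fun t => f (Phi 1 t) * (z + 1%:C * (w - z))) =
    cint 0 1 (fun t => f (t%:C * w) * w).
  by apply: eq_cint => t _; rewrite PhiE mul1r addrC subrK.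
have -> : cint 0 1 (fun t => f (Phi 0 t) * (z + 0%:C * (w - z))) =
    cint 0 1 (fun t => f (t%:C * z) * z).
  by apply: eq_cint => t _; rewrite PhiE mul0r addr0.
have -> : cint 0 1 (fun s => f (Phi s 1) * (1%:C * (w - z))) =
    cint 0 1 (fun s => f (z + s%:C * (w - z)) * (w - z)).
  by apply: eq_cint => t _; rewrite PhiE !mul1r.
(* The collapsed side [t = 0] has zero velocity. *)
have -> : cint 0 1 (fun s => f (Phi s 0) * (0%:C * (w - z))) = 0.
  rewrite (@eq_cint _ 0 1 _ (fun=> 0)); last by move=> t _; rewrite mul0r mulr0.
  by rewrite cint_cst// mulr0.
rewrite subr0; apply.
- move=> s t _ _; exact: path_deriv_segment.
- move=> s t _ _; rewrite /Phi.
  have := path_deriv_ray (z + s%:C * (w - z)) t; congr path_deriv.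
  by apply/funext => u; rewrite -PhiE.
- move=> t _; exact: ccont_cst.
- move=> s _; exact: ccont_cst.
- move=> s t _ /andP[t0 t1]; rewrite cmodM cmod_real ger0_norm//.
  by have := cmod_ge0 (w - z); nra.
- by move=> s t s01 _; apply/ltW/lt_trans; [apply: cmod_segment; eassumption|lra].
- by move=> s t s01 t01; rewrite PhiE; apply: fa; apply: cmod_scale_lt1 => //; exact: cmod_segment.
Qed.

(** The remainder is the integral of [f - f z] over the segment from z to w, small against [|w - z|]
    by continuity of f at z. *)
Lemma ray_primitive_is_derive (f : C -> C) (z : C) : analytic_disc f -> cmod z < 1 ->
  is_derive z 1 (ray_primitive f) (f z).
Proof.
move=> fa z1; apply/is_derive_littleoP => -[e1 e2] e0.
have e10 : 0 < e1 by move: e0; rewrite ltcE /= => /andP[_].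
have {e0} -> : e2 = 0 by move: e0; rewrite ltcE /= => /andP[/eqP].
have e20 : 0 < e1 / 2 by rewrite divr_gt0.
have [d d0 dP] := near_derivable_cvg (fa z z1) e20.
apply/(near_cmodP z (fun w => `|ray_primitive f w - ray_primitive f z - f z * (w - z)|
  <= e1%:C * `|w - z|)).
exists (Num.min d (1 - cmod z)); first by rewrite lt_min d0 subr_gt0.
move=> w; rewrite lt_min => /andP[wd wz].
have w1 : cmod w < 1.
  by have := cmodD (w - z) z; rewrite subrK; lra.
rewrite !norm_cmod -rmorphM lecR ray_primitive_diff//.
have fc : ccont 0 1 (fun s => f (z + s%:C * (w - z)) * (w - z)).
  apply: ccontM; last exact: ccont_cst.
  apply: ccont_comp; first exact: ccont_segment.
  by move=> s s01; apply: fa; exact: cmod_segment.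
have -> : f z * (w - z) = cint 0 1 (fun=> f z * (w - z)).
  by rewrite cint_cst// subr0 mul1r.
rewrite -(cintB fc (ccont_cst _ _ _)).
have -> : e1 * cmod (w - z) = 2 * (e1 / 2 * cmod (w - z)) * (1 - 0) by field.
apply: cmod_cint_le_cst => //; first exact: (ccontD fc (ccontN (ccont_cst _ _ _))).
move=> s /andP[s0 s1]; rewrite -mulrBl cmodM ler_wpM2r ?cmod_ge0//; apply/ltW/dP.
rewrite addrAC subrr add0r cmodM cmod_real ger0_norm//.
by apply: le_lt_trans wd; rewrite ler_piMl ?cmod_ge0.
Qed.

End Analytic.

(** * Hardy means and the Volterra operator *)

Section HardyMeans.
Variable R : realType.
Local Notation C := (R[i])^o.
Local Notation tau := (2 * pi : R).
Local Notation mu := (@lebesgue_measure R).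
Local Notation I := (`[0%R, tau] : set R).

Lemma polar_form (z : C) : exists2 t, 0 <= t <= tau & z = (cmod z)%:C * expi t.
Proof.
have pi0 := @pi_ge0 R.
have [->|z0] := eqVneq z 0.
  by exists 0; [rewrite lexx ltW// tau_gt0|rewrite cmod0 mul0r].
have cz : 0 < cmod z by rewrite cmod_gt0.
pose x := complex.Re z / cmod z; pose y := complex.Im z / cmod z.
have xy : x ^+ 2 + y ^+ 2 = 1.
  have : cmod z ^+ 2 = complex.Re z ^+ 2 + complex.Im z ^+ 2.
    by case: (z) => u v; rewrite /cmod /= sqr_sqrtr// addr_ge0// sqr_ge0.
  rewrite /x /y !expr_div_n -mulrDl => <-.
  by rewrite divff// expf_neq0// gt_eqF.
have x1 : -1 <= x <= 1.
  by have y2 := sqr_ge0 y; apply/andP; split; nra.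
have zE t : cos t = x -> sin t = y -> z = (cmod z)%:C * expi t.
  move=> ct st; apply: complex_ext; rewrite /expi !ReImE /= ct st /x /y !mul0r.
    by rewrite subr0 mulrC divfK// gt_eqF.
  by rewrite addr0 mulrC divfK// gt_eqF.
have cx : cos (acos x) = x by apply: acosK; rewrite in_itv.
have sx : sin (acos x) = `|y|.
  by rewrite sin_acos// -xy addrAC subrr add0r sqrtr_sqr.
have [a0 a1] := (acos_ge0 x1, acos_lepi x1).
have [y0|y0] := leP 0 y.
  by exists (acos x); [lra|apply: zE => //; rewrite sx ger0_norm].
(* [acos] only reaches the upper half plane; in the lower one the angle is reflected, which keeps
   the cosine and changes the sign of the sine. *)
exists (tau - acos x); first by lra.
have tauE : tau = pi *+ 2 by rewrite mulr_natl.
apply: zE; rewrite tauE.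
  by rewrite cosB cos2pi sin2pi cx mul1r mul0r addr0.
by rewrite sinB cos2pi sin2pi sx mul0r mul1r sub0r ltr0_norm// opprK.
Qed.

Lemma in_circle_lt1 (r t : R) : 0 < r < 1 -> cmod (r%:C * expi t : C) < 1.
Proof.
by move=> /andP[r0 r1]; rewrite cmodM cmod_real cmod_expi mulr1 gtr0_norm.
Qed.

Lemma ccont_circle (f : C -> C) a b r : analytic_disc f -> 0 < r < 1 ->
  ccont a b (fun t => f (r%:C * expi t)).
Proof.
move=> fa r01; apply: ccont_comp.
  exact: (ccontM (ccont_cst _ _ _) (ccont_expi _ _)).
by move=> t _; apply: fa; exact: in_circle_lt1.
Qed.

Lemma measurable_cmod (h : R -> C) a b : ccont a b h ->
  measurable_fun `[a, b] (fun t => cmod (h t)).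
Proof.
by move=> hc; apply/measurable_EFinP; exact: measurable_int (integrable_cmod hc).
Qed.

Lemma measurable_cmod_powR (h : R -> C) a b p : ccont a b h ->
  measurable_fun `[a, b] (fun t => cmod (h t) `^ p).
Proof.
by move=> hc; apply: (measurableT_comp (measurable_powR p)); exact: measurable_cmod.
Qed.

(** Stated in extended reals because [v] is only assumed measurable. It serves both to compare L^1
    with L^p means and to bound the means of (T_g f)''. *)
Lemma integral_affine_le (u v : R -> R) (a b : R) : 0 <= a -> 0 <= b ->
  measurable_fun I u -> measurable_fun I v ->
  (forall t, 0 <= u t) -> (forall t, 0 <= v t) -> (forall t, u t <= a + b * v t) ->
  (\int[mu]_(t in I) (u t)%:E <= (a * tau)%:E + b%:E * \int[mu]_(t in I) (v t)%:E)%E.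
Proof.
move=> a0 b0 mu' mv u0 v0 uv.
have mI : measurable I by exact: measurable_itv.
have mbv : measurable_fun I (fun t => b * v t) by exact: measurable_funM.
apply: (@le_trans _ _ (\int[mu]_(t in I) (a%:E + b%:E * (v t)%:E))%E).
  apply: ge0_le_integral => //.
  - by move=> t _; rewrite lee_fin.
  - exact/measurable_EFinP.
  - by apply/measurable_EFinP; exact: measurable_funD.
  - by move=> t _; rewrite -EFinM -EFinD lee_fin.
rewrite ge0_integralD//; last first.
- exact/measurable_EFinP.
- by move=> t _; rewrite lee_fin mulr_ge0.
rewrite (integral_cst mu mI a%:E) /= lebesgue_measure_itv /= lte_fin tau_gt0 -EFinB subr0.
rewrite -EFinM leeD2l// ge0_integralZl_EFin//.
  by move=> t _; rewrite lee_fin.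
exact/measurable_EFinP.
Qed.

Lemma Mp_pow_le (p : R) (f : C -> C) r : 0 < r < 1 -> (Mp_pow p f r <= Hp_pow p f)%E.
Proof. by move=> r01; apply: ereal_sup_ubound; exists r => //=; rewrite in_itv. Qed.

Lemma Mp_pow_ge0 (p : R) (f : C -> C) r : (0 <= Mp_pow p f r)%E.
Proof.
rewrite mule_ge0//; first by rewrite lee_fin invr_ge0 ltW// tau_gt0.
by apply: integral_ge0 => t _; rewrite lee_fin powR_ge0.
Qed.

Lemma Hp_pow_ge0 (p : R) (f : C -> C) : (0 <= Hp_pow p f)%E.
Proof.
by apply: le_trans (Mp_pow_ge0 p f 2^-1) (Mp_pow_le _ _ _); lra.
Qed.

(** Functions are total on [C], but identities between derivatives are only known inside the disc,
    where all the circles of the means lie. *)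
Lemma eq_Hp_pow (p : R) (f g : C -> C) : (forall z, cmod z < 1 -> f z = g z) ->
  Hp_pow p f = Hp_pow p g.
Proof.
move=> fg; congr ereal_sup; apply: eq_imagel => r /=; rewrite in_itv /= => r01.
by congr (_ * _)%E; apply: eq_integral => t _; rewrite fg// in_circle_lt1.
Qed.

Lemma integral_Mp (p : R) (f : C -> C) r :
  (\int[mu]_(t in I) (cmod (f (r%:C * expi t)) `^ p)%:E)%E = (tau%:E * Mp_pow p f r)%E.
Proof.
by rewrite /Mp_pow muleA -EFinM divff ?mul1e// gt_eqF// tau_gt0.
Qed.

(* With l the H^p norm, this compares L^1 and L^p means without Hoelder. *)
Lemma le_affine_powR (p l x : R) : 1 <= p -> 0 < l -> 0 <= x ->
  x <= l + l / l `^ p * x `^ p.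
Proof.
move=> p1 l0 x0; have [xl|lx] := leP x l.
  by rewrite (le_trans xl)// lerDl mulr_ge0 ?powR_ge0// divr_ge0 ?powR_ge0// ltW.
apply: (@le_trans _ _ (l / l `^ p * x `^ p)); last by rewrite lerDr ltW.
have : x / l <= (x / l) `^ p by rewrite le1r_powR// ler_pdivlMr// mul1r ltW.
rewrite powRM ?invr_ge0 ?(ltW l0)// -powR_inv1 ?(ltW l0)// powRAC.
rewrite (powR_inv1 (powR_ge0 _ _)) (powR_inv1 (ltW l0)).
rewrite ler_pdivrMr// => H.
by have -> : l / l `^ p * x `^ p = x `^ p * (l `^ p)^-1 * l by ring.
Qed.

Lemma Hp_norm_ge0 (p : R) (f : C -> C) : 0 <= Hp_norm p f.
Proof. exact: powR_ge0. Qed.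

(** [fine] sends +oo to 0, so [Hp_norm] speaks about the supremum of the means only once that is
    known to be finite. *)
Lemma Hp_pow_fine (p : R) (f : C -> C) : (Hp_pow p f < +oo)%E ->
  Hp_pow p f = (fine (Hp_pow p f))%:E.
Proof. by move=> fin; rewrite fineK// ge0_fin_numE// Hp_pow_ge0. Qed.

Lemma L1_le_Hp_norm (p : R) (f : C -> C) r : 1 <= p -> in_Hp p f -> 0 < r < 1 ->
  \int[mu]_(t in I) cmod (f (r%:C * expi t)) <= 2 * tau * Hp_norm p f.
Proof.
move=> p1 [fa fin] r01; have p0 : 0 < p by exact: lt_le_trans p1.
have t0 : 0 < tau by exact: tau_gt0.
apply/ler_addgt0Pl => e e0.
(* The norm may be 0 while the affine comparison divides by a power of [l], hence the positive
   excess. The two terms of the comparison contribute [l tau] each, and the excess sums to [e]. *)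
pose l := Hp_norm p f + e / (2 * tau).
have l0 : 0 < l by rewrite ltr_wpDl ?Hp_norm_ge0// divr_gt0// mulr_gt0.
have -> : e + 2 * tau * Hp_norm p f = l * tau + l * tau.
  by rewrite /l; move: (tau) t0 => T T0; field; rewrite gt_eqF.
have fc := ccont_circle 0 tau fa r01.
have lp : (Mp_pow p f r <= (l `^ p)%:E)%E.
  apply: le_trans (Mp_pow_le p f r01) _; rewrite (Hp_pow_fine fin) lee_fin.
  have H0 : 0 <= fine (Hp_pow p f) by rewrite fine_ge0// Hp_pow_ge0.
  rewrite -[leLHS]powRr1// -(mulVf (lt0r_neq0 p0)) powRrM.
  rewrite ge0_ler_powR ?nnegrE ?powR_ge0 ?(ltW p0) ?(ltW l0)//.
  by rewrite /l lerDl divr_ge0 ?ltW// mulr_gt0.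
have B : (\int[mu]_(t in I) (cmod (f (r%:C * expi t)))%:E <= (l * tau + l * tau)%:E)%E.
  apply: le_trans (@integral_affine_le _ (fun t => cmod (f (r%:C * expi t)) `^ p)
    l (l / l `^ p) (ltW l0) _ _ _ _ _ _) _.
  - by rewrite divr_ge0 ?powR_ge0// ltW.
  - exact: measurable_cmod.
  - exact: measurable_cmod_powR.
  - by move=> t; exact: cmod_ge0.
  - by move=> t; exact: powR_ge0.
  - by move=> t; apply: le_affine_powR => //; exact: cmod_ge0.
  rewrite EFinD leeD2l// integral_Mp.
  apply: (@le_trans _ _ ((l / l `^ p)%:E * (tau%:E * (l `^ p)%:E))%E).
    rewrite lee_wpmul2l ?lee_fin ?divr_ge0 ?powR_ge0 ?(ltW l0)//.
    by rewrite lee_wpmul2l ?lee_fin ?(ltW t0).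
  rewrite -!EFinM lee_fin le_eqVlt; apply/orP; left; apply/eqP.
  by field; rewrite gt_eqF// powR_gt0.
rewrite -lee_fin; apply: le_trans B.
by rewrite /Rintegral fineK// integrable_fin_num//; exact: integrable_cmod.
Qed.

(** The sum is at most twice the larger term; this needs no convexity and holds for every
    [p >= 0]. *)
Lemma powRD_le (p x y : R) : 0 <= p -> 0 <= x -> 0 <= y ->
  (x + y) `^ p <= 2 `^ p * (x `^ p + y `^ p).
Proof.
move=> p0 x0 y0.
wlog xy : x y x0 y0 / x <= y.
  move=> H; have [/H|/ltW/H] := leP x y; first exact.
  by rewrite addrC [_ `^ _ + _]addrC; exact.
apply: (@le_trans _ _ ((2 * y) `^ p)).
  by rewrite ge0_ler_powR ?nnegrE ?addr_ge0 ?mulr_ge0//; lra.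
by rewrite powRM// ler_wpM2l ?powR_ge0// lerDr powR_ge0.
Qed.

(** [A] is kept as an overall factor: it will be a multiple of the norm of the argument of T_g, and
    taking the p-th root must give a bound linear in it. *)
Lemma Hp_pow_le_affine (p A G : R) (f k : C -> C) : 0 <= p -> 0 <= A -> 0 <= G ->
  analytic_disc f -> in_Hp p k ->
  (forall z, cmod z < 1 -> cmod (f z) <= A * (G + cmod (k z))) ->
  (Hp_pow p f <= ((2 * A) `^ p * (G `^ p + fine (Hp_pow p k)))%:E)%E.
Proof.
move=> p0 A0 G0 fa [ka kfin] fk; apply: ge_ereal_sup => _ [r /= + <-].
rewrite in_itv /= => r01; have t0 : 0 < tau by exact: tau_gt0.
rewrite /Mp_pow lee_pdivrMl//.
apply: le_trans (@integral_affine_le _ (fun t => cmod (k (r%:C * expi t)) `^ p)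
  ((2 * A) `^ p * G `^ p) ((2 * A) `^ p) _ _ _ _ _ _ _) _.
- by rewrite mulr_ge0 ?powR_ge0.
- exact: powR_ge0.
- by apply: measurable_cmod_powR; exact: ccont_circle.
- by apply: measurable_cmod_powR; exact: ccont_circle.
- by move=> t; exact: powR_ge0.
- by move=> t; exact: powR_ge0.
- move=> t; have fkt := fk _ (in_circle_lt1 t r01).
  apply: (@le_trans _ _ ((A * (G + cmod (k (r%:C * expi t)))) `^ p)).
    by rewrite ge0_ler_powR ?nnegrE ?mulr_ge0 ?addr_ge0 ?cmod_ge0.
  rewrite powRM ?addr_ge0 ?cmod_ge0// [(2 * A) `^ p]powRM// -mulrDr [_ * A `^ p]mulrC.
  by rewrite -mulrA ler_wpM2l ?powR_ge0// powRD_le ?cmod_ge0.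
rewrite -[leRHS]EFinM.
have -> : (tau * ((2 * A) `^ p * (G `^ p + fine (Hp_pow p k))) =
  (2 * A) `^ p * G `^ p * tau + (2 * A) `^ p * (tau * fine (Hp_pow p k)))%R by ring.
rewrite integral_Mp EFinD leeD2l// [leRHS]EFinM lee_wpmul2l ?lee_fin ?powR_ge0//.
by rewrite [leRHS]EFinM lee_wpmul2l ?lee_fin ?(ltW t0)// -Hp_pow_fine// Mp_pow_le.
Qed.

End HardyMeans.

(** * Uniform bounds for f and f' by the norm of f *)

Section SupremumBounds.
Variable R : realType.
Local Notation C := (R[i])^o.
Local Notation tau := (2 * pi : R).
Local Notation mu := (@lebesgue_measure R).

Lemma Rintegral_subset_le a b a' b' (f : R -> R) : a <= a' -> b' <= b ->
  (forall t, 0 <= f t) -> mu.-integrable `[a, b] (EFin \o f) ->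
  \int[mu]_(t in `[a', b']) f t <= \int[mu]_(t in `[a, b]) f t.
Proof.
move=> aa bb f0 fi.
have sub : `[a', b'] `<=` `[a, b] by apply: subset_itv; rewrite bnd_simp.
have fi' : mu.-integrable `[a', b'] (EFin \o f) by exact: integrableS fi.
rewrite /Rintegral fine_le ?integrable_fin_num//.
apply: ge0_subset_integral => //; first exact: measurable_int fi.
by move=> t _; rewrite lee_fin.
Qed.

(** The derivative of [u(r e^(it))] in t has modulus [r |u'| <= |u'|], and an arc contributes no
    more than the full circle. *)
Lemma circle_oscillation (u : C -> C) r L t1 t2 : analytic_disc u -> 0 < r < 1 ->
  \int[mu]_(t in `[0, tau]) cmod (cderiv u (r%:C * expi t)) <= L ->
  0 <= t1 <= tau -> 0 <= t2 <= tau ->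
  cmod (u (r%:C * expi t1) - u (r%:C * expi t2)) <= 2 * L.
Proof.
move=> ua r01 uL; have u'a := analytic_cderiv ua.
have ic := integrable_cmod (ccont_circle 0 tau u'a r01).
have main s1 s2 : 0 <= s1 -> s1 <= s2 -> s2 <= tau ->
    cmod (u (r%:C * expi s2) - u (r%:C * expi s1)) <= 2 * L.
  move=> s10 s12 s2t.
  pose h t : C := cderiv u (r%:C * expi t) * (r%:C * ('i * expi t)).
  have hc a b : ccont a b h.
    apply: ccontM; first exact: ccont_circle.
    exact: (ccontM (ccont_cst _ _ _) (ccontM (ccont_cst _ _ _) (ccont_expi _ _))).
  rewrite -(@cint_FTC _ s1 s2 (fun t => u (r%:C * expi t)) h)//; last first.
    move=> t _; apply: path_deriv_comp.
      by apply: is_cderiv; apply: ua; exact: in_circle_lt1.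
    apply: path_deriv_eq.
      exact: path_derivM (path_deriv_cst r%:C t) (path_deriv_expi t).
    by rewrite mul0r addr0.
  apply: le_trans (cmod_cint_le (hc _ _)) _; rewrite ler_pM2l//.
  apply: le_trans uL; apply: le_trans (_ : \int[mu]_(t in `[s1, s2])
      cmod (cderiv u (r%:C * expi t)) <= _).
    apply: le_Rintegral => //; first exact: integrable_cmod.
      by apply: integrable_cmod; exact: ccont_circle.
    move=> t _; rewrite !cmodM cmod_real cmod_expi.
    rewrite cmod_i.
    case/andP: r01 => r0 r1; rewrite !mulr1 gtr0_norm// ler_piMr ?cmod_ge0//.
    exact: ltW.
  by apply: Rintegral_subset_le => // t; exact: cmod_ge0.
move=> /andP[t10 t1t] /andP[t20 t2t]; have [t12|/ltW t21] := leP t1 t2.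
  by rewrite cmodB; exact: main.
exact: main.
Qed.

(** By the mean value property, [tau (u z - u 0)] is the integral of [u z - u] over the circle
    through z. The oscillation there is at most [2 L], and integrating costs another 2. *)
Lemma cderiv_integral_bound (u : C -> C) L z : analytic_disc u -> 0 <= L ->
  (forall r, 0 < r < 1 ->
    \int[mu]_(t in `[0, tau]) cmod (cderiv u (r%:C * expi t)) <= L) ->
  cmod z < 1 -> cmod (u z - u 0) <= 4 * L.
Proof.
move=> ua L0 uL z1; have t0 : 0 < tau by exact: tau_gt0.
have [->|z0] := eqVneq z 0; first by rewrite subrr cmod0 mulr_ge0.
have r01 : 0 < cmod z < 1 by rewrite cmod_gt0 z0.
have [t tt zE] := polar_form z.
have uc := ccont_circle 0 tau ua r01.
suff : cmod (tau%:C * (u z - u 0)) <= 2 * (2 * L) * (tau - 0).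
  rewrite cmodM cmod_real (gtr0_norm t0) subr0 [leLHS]mulrC ler_pM2r//.
  by rewrite mulrA -[2 * 2]/(2 * 2 : R); lra.
rewrite mulrBr -(mean_value ua r01) -[tau in tau%:C * u z]subr0 -cint_cst ?(ltW t0)//.
rewrite -(cintB (ccont_cst _ _ _) uc).
apply: cmod_cint_le_cst; first exact: ltW.
  exact: (ccontD (ccont_cst _ _ _) (ccontN uc)).
by move=> s st; rewrite {1}zE; apply: circle_oscillation => //; exact: uL.
Qed.

Lemma ray_bound (f : C -> C) B z : analytic_disc f ->
  (forall w, cmod w < 1 -> cmod (cderiv f w) <= B) ->
  cmod z < 1 -> cmod (f z) <= cmod (f 0) + 2 * B.
Proof.
move=> fa fB z1; rewrite -[f z](subrK (f 0)) addrC.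
apply: le_trans (cmodD _ _) _; rewrite lerD2l -cint_ray_cderiv//.
have B0 : 0 <= B by apply: le_trans (fB z z1); exact: cmod_ge0.
have -> : 2 * B = 2 * B * (1 - 0) by rewrite subr0 mulr1.
apply: cmod_cint_le_cst => //.
  apply: ccontM; last exact: ccont_cst.
  apply: ccont_comp; first exact: ccont_ray.
  by move=> t t01; apply: (analytic_cderiv fa); exact: cmod_scale_lt1.
move=> t t01; rewrite cmodM -[leRHS]mulr1.
by apply: ler_pM; rewrite ?cmod_ge0// ?fB ?cmod_scale_lt1// ltW.
Qed.

Lemma S2p_norm_ge0 (p : R) (f : C -> C) : 0 <= S2p_norm p f.
Proof. by rewrite !addr_ge0 ?cmod_ge0 ?Hp_norm_ge0. Qed.

(** [8 tau] is the 4 of the oscillation bound times the [2 tau] of the L^1 bound, and the inner 1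
    accounts for [|f'(0)|]. Integrating f' along a ray doubles this, and the last 1 accounts for
    [|f(0)|]. *)
Definition S2p_sup_const : R := 2 * (8 * tau + 1) + 1.

Lemma S2p_sup_bound (p : R) (f : C -> C) z : 1 <= p -> in_S2p p f -> cmod z < 1 ->
  cmod (f z) <= S2p_sup_const * S2p_norm p f /\
  cmod (cderiv f z) <= S2p_sup_const * S2p_norm p f.
Proof.
move=> p1 [fa f''H] z1; have t0 : 0 < tau by exact: tau_gt0.
have f'a := analytic_cderiv fa.
set N := S2p_norm p f; pose B := (8 * tau + 1) * N.
have H0 := Hp_norm_ge0 p (cderiv (cderiv f)).
have [c0 c1] := (cmod_ge0 (f 0), cmod_ge0 (cderiv f 0)).
have f'B w : cmod w < 1 -> cmod (cderiv f w) <= B.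
  move=> w1; have L0 : 0 <= 2 * tau * Hp_norm p (cderiv (cderiv f)).
    by rewrite !mulr_ge0// ltW// pi_gt0.
  have := @cderiv_integral_bound (cderiv f) _ w f'a L0 _ w1.
  move=> /(_ (fun r r01 => L1_le_Hp_norm p1 f''H r01)) H.
  rewrite -[cderiv f w](subrK (cderiv f 0)).
  apply: le_trans (cmodD _ _) _; apply: le_trans (lerD H (lexx _)) _.
  rewrite /B /N /S2p_norm.
  have : 0 <= tau * (cmod (f 0) + cmod (cderiv f 0)) by apply: mulr_ge0; [exact: ltW|exact: addr_ge0].
  by move: (tau) t0 => T T0 ?; lra.
have N0 : 0 <= N by exact: S2p_norm_ge0.
have tN : 0 <= tau * N by rewrite mulr_ge0// ltW.
split.
  apply: le_trans (ray_bound fa f'B z1) _; rewrite /S2p_sup_const /B.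
  have : cmod (f 0) <= N by rewrite /N /S2p_norm; lra.
  by move: (tau) tN => T TN ?; lra.
apply: le_trans (f'B z z1) _; rewrite /B /S2p_sup_const.
by move: (tau) tN => T TN; nra.
Qed.

End SupremumBounds.

(** * Derivatives of T_g f and the two implications *)

Section Volterra.
Variable R : realType.
Local Notation C := (R[i])^o.
Local Opaque cderiv.

(** Shaped for f' g' + f g'': [A] bounds both f and f', [G] bounds g', and g'' is left as it is. *)
Lemma cmod_bilinear_le (a b c d : C) (A G : R) :
  cmod a <= A -> cmod b <= G -> cmod c <= A ->
  cmod (a * b + c * d) <= A * (G + cmod d).
Proof.
move=> aA bG cA; apply: le_trans (cmodD _ _) _; rewrite !cmodM mulrDr.
by apply: lerD; [apply: ler_pM; rewrite ?cmod_ge0|rewrite ler_wpM2r ?cmod_ge0].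
Qed.

Lemma powRM_root (p x y : R) : 0 < p -> 0 <= x -> 0 <= y ->
  (x `^ p * y) `^ p^-1 = x * y `^ p^-1.
Proof.
move=> p0 x0 y0.
by rewrite (powRM _ (powR_ge0 _ _) y0) -powRrM mulfV ?gt_eqF// powRr1.
Qed.

(** Holds by conversion, [cint01] and [cint 0 1] having the same body. *)
Lemma TgE (g f : C -> C) : Tg g f = ray_primitive (fun w => f w * cderiv g w).
Proof. by []. Qed.

Lemma analyticM (f g : C -> C) : analytic_disc f -> analytic_disc g ->
  analytic_disc (fun w => f w * g w).
Proof. by move=> fa ga z z1; apply: (@derivableM _ _ f g); [exact: fa|exact: ga]. Qed.

Lemma is_derive_prod (f g : C -> C) (z d e : C) : is_derive z 1 f d ->
  is_derive z 1 g e -> is_derive z 1 (fun w => f w * g w) (d * g z + f z * e).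
Proof.
move=> fd gd; have := is_deriveM fd gd.
by rewrite /GRing.scale /= addrC [g z * d]mulrC.
Qed.

Lemma cderiv_eq_disc (f g : C -> C) (z : C) : analytic_disc f -> cmod z < 1 ->
  (forall w, cmod w < 1 -> f w = g w) -> cderiv f z = cderiv g z.
Proof.
move=> fa z1 fg; apply/esym/cderivE.
exact: (is_derive_eq_disc z1 fg (is_cderiv (fa z z1))).
Qed.

Section TgDerivatives.
Variables g f : C -> C.
Hypotheses (ga : analytic_disc g) (fa : analytic_disc f).

Let fg'a : analytic_disc (fun w => f w * cderiv g w).
Proof. exact: (analyticM fa (analytic_cderiv ga)). Qed.

Lemma analytic_Tg : analytic_disc (Tg g f).
Proof. by move=> z z1; have [] := ray_primitive_is_derive fg'a z1. Qed.

Lemma cderiv_Tg z : cmod z < 1 -> cderiv (Tg g f) z = f z * cderiv g z.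
Proof. by move=> z1; exact: (cderivE (ray_primitive_is_derive fg'a z1)). Qed.

Lemma cderiv2_Tg z : cmod z < 1 ->
  cderiv (cderiv (Tg g f)) z = cderiv f z * cderiv g z + f z * cderiv (cderiv g) z.
Proof.
move=> z1.
have fd := is_cderiv (fa z1); have gd := is_cderiv (analytic_cderiv ga z1).
rewrite -(cderivE (is_derive_prod fd gd)).
exact: (cderiv_eq_disc (analytic_cderiv analytic_Tg) z1 cderiv_Tg).
Qed.

Lemma Tg_at0 : Tg g f 0 = 0.
Proof.
rewrite TgE /ray_primitive (@eq_cint _ 0 1 _ (fun=> 0)).
  by rewrite cint_cst// mulr0.
by move=> t _; rewrite mulr0.
Qed.

End TgDerivatives.

Lemma cderiv_cst (c : C) : cderiv (fun=> c) = (fun=> 0).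
Proof. by apply/funext => z; apply: cderivE; exact: is_derive_cst. Qed.

Lemma in_S2p_cst (p : R) (c : C) : 1 <= p -> in_S2p p (fun=> c).
Proof.
move=> p1; have ca (d : C) : analytic_disc (fun=> d) by move=> z _; exact: derivable_cst.
split; first exact: ca.
rewrite (cderiv_cst c) (cderiv_cst 0); split; first exact: ca.
apply: (@le_lt_trans _ _ 0%:E); last exact: ltry.
apply: ge_ereal_sup => _ [r _ <-]; rewrite /Mp_pow.
under eq_integral do rewrite cmod0 powR0 ?gt_eqF ?(lt_le_trans ltr01)//.
by rewrite integral0 mule0.
Qed.

Lemma Tg_bounded_in_S2p (p : R) (g : C -> C) : 1 <= p -> analytic_disc g ->
  Tg_bounded_S2p p g -> in_S2p p g.
Proof.
move=> p1 ga [TS _]; have [Ta [_ Tfin]] := TS _ (in_S2p_cst 1 p1).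
have g'a := analytic_cderiv ga.
split; first exact: ga.
split; first exact: (analytic_cderiv g'a).
have oa : analytic_disc (fun=> 1 : C) by move=> w _; exact: derivable_cst.
(* For the constant 1 the term f' g' vanishes and f g'' is g'' itself. *)
have E z : cmod z < 1 -> cderiv (cderiv g) z = cderiv (cderiv (Tg g (fun=> 1))) z.
  move=> z1.
  have c1 : cderiv (fun=> 1 : C) z = 0.
    exact: (congr1 (fun h => h z) (cderiv_cst 1)).
  apply: esym; apply: (etrans (cderiv2_Tg ga oa z1)).
  by rewrite c1 mul0r add0r mul1r.
by rewrite (eq_Hp_pow p E); exact: Tfin.
Qed.

Lemma in_S2p_Tg_bounded (p : R) (g : C -> C) : 1 <= p ->
  in_S2p p g -> Tg_bounded_S2p p g.
Proof.
move=> p1 gS; have [ga [g''a gfin]] := gS; have p0 : 0 < p by exact: lt_le_trans p1.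
pose c := S2p_sup_const R.
have c0 : 0 <= c.
  by rewrite /c /S2p_sup_const; have := @tau_gt0 R; move: (2 * pi) => T T0; lra.
pose G := c * S2p_norm p g.
have G0 : 0 <= G by rewrite mulr_ge0// S2p_norm_ge0.
pose H := G `^ p + fine (Hp_pow p (cderiv (cderiv g))).
have H0 : 0 <= H by rewrite addr_ge0 ?powR_ge0// fine_ge0// Hp_pow_ge0.
have bound f : in_S2p p f -> (Hp_pow p (cderiv (cderiv (Tg g f))) <=
    ((2 * (c * S2p_norm p f)) `^ p * H)%:E)%E.
  move=> fS; have [fa _] := fS.
  have N0 : 0 <= c * S2p_norm p f by rewrite mulr_ge0// S2p_norm_ge0.
  apply: (Hp_pow_le_affine (ltW p0) N0 G0).
  - exact: (analytic_cderiv (analytic_cderiv (analytic_Tg ga fa))).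
  - by split; [exact: g''a|exact: gfin].
  move=> z z1; rewrite [X in cmod X <= _](cderiv2_Tg ga fa z1).
  have [f1 f2] := S2p_sup_bound p1 fS z1; have [_ g2] := S2p_sup_bound p1 gS z1.
  exact: (cmod_bilinear_le _ f2 g2 f1).
split.
  move=> f fS; have [fa _] := fS; split; first exact: (analytic_Tg ga fa).
  split; first exact: (analytic_cderiv (analytic_cderiv (analytic_Tg ga fa))).
  exact: le_lt_trans (bound f fS) (ltry _).
(* T_g f vanishes at 0 and its derivative there is [f 0] times g'(0), whence the first summand; the
   second is the p-th root of [bound] divided by the norm of f. *)
exists (cmod (cderiv g 0) + 2 * c * H `^ p^-1) => f fS; have [fa _] := fS.
have d0 : cmod (0 : C) < 1 by rewrite cmod0.
have N0 := S2p_norm_ge0 p f.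
have -> : S2p_norm p (Tg g f) =
    cmod (f 0 * cderiv g 0) + Hp_norm p (cderiv (cderiv (Tg g f))).
  rewrite /S2p_norm Tg_at0 cmod0 add0r; congr (cmod _ + _).
  exact: (cderiv_Tg ga fa d0).
rewrite mulrDl.
apply: lerD.
  have f0 : cmod (f 0) <= S2p_norm p f.
    by rewrite /S2p_norm -addrA lerDl addr_ge0 ?cmod_ge0 ?Hp_norm_ge0.
  by rewrite (cmodM (f 0)) mulrC; exact: (ler_wpM2l (cmod_ge0 _) f0).
have A0 : 0 <= 2 * (c * S2p_norm p f) by rewrite !mulr_ge0.
apply: (@le_trans _ _ (((2 * (c * S2p_norm p f)) `^ p * H) `^ p^-1)).
  have b0 : 0 <= (2 * (c * S2p_norm p f)) `^ p * H by rewrite mulr_ge0 ?powR_ge0.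
  rewrite ge0_ler_powR ?nnegrE ?invr_ge0 ?(ltW p0) ?fine_ge0 ?Hp_pow_ge0//.
  have fin : (Hp_pow p (cderiv (cderiv (Tg g f))) < +oo)%E.
    exact: le_lt_trans (bound f fS) (ltry _).
  by rewrite -lee_fin -Hp_pow_fine//; exact: bound.
rewrite (powRM_root p0 A0 H0) le_eqVlt; apply/orP; left; apply/eqP.
by move: (S2p_norm p f) (H `^ p^-1) => N K; ring.
Qed.

End Volterra.

Unset Implicit Arguments.

Theorem theorem4p1 (R : realType) (p : R) (hp : 1 <= p) (g : (R[i])^o -> (R[i])^o) :
  analytic_disc g -> (Tg_bounded_S2p p g <-> in_S2p p g).
Proof.
move=> ga; split; first exact: Tg_bounded_in_S2p.
exact: in_S2p_Tg_bounded.
Qed.
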